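(* Let $\omega=(\tilde\omega,\omega_d)\in\mathbb R^d$, $d\geq3$, be non-resonant with $\tilde\omega\in\mathbb R^{d-1}$ such that there is a sequence $\{\bar k_j\}\subset\mathbb Z^{d-1}$ with $\lim_{j\to\infty}\frac{\ln|\langle\tilde\omega,\bar k_j\rangle|}{\|\bar k_j\|}=-\infty$. Then: (a) there exists a real entire Hamiltonian $H$ of the form $H(\theta,r)=\langle\omega,r\rangle+\mathcal O(r^2)$ whose Birkhoff normal form at $\mathcal{T}_0$ is $N(r)=\langle\omega,r\rangle$, and such that $\mathcal{T}_0$ is diffusive with $T(r_n)\leq r_n^{-n}$ for a sequence $r_n\to0$; (b) there exists a real entire Hamiltonian $H$ of the form $H(\theta,r)=\langle\omega,r\rangle+\mathcal O(r^2)$ such that $\mathcal{T}_0$ is diffusive and $T(r_n)\leq r_n^{-4}$ for a sequence $r_n\to0$.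
   Context: $\mathcal{T}_0=\mathbb{T}^d\times\{0\}$; $\|k\|=\max_m|k_m|$; non-resonant means the coordinates of $\omega$ are rationally independent. Real entire: extends holomorphically to $(\mathbb C/\mathbb Z)^d\times\mathbb C^d$, real on real arguments. $\Phi^t_H$ is the Hamiltonian flow for $d\theta\wedge dr$. $T(r)=\inf_{\theta\in\mathbb{T}^d,|r'|\leq r}\{t>0:\operatorname{dist}(\Phi^t_H(\theta,r'),\mathcal{T}_0)=1/r\}$; $\mathcal{T}_0$ is diffusive if $T(r)$ exists for all sufficiently small $r>0$. Birkhoff normal form: formal power series $N_H(r)$ such that some formal series $f(\theta,r)=\sum_j a_j(\theta)r^j=\mathcal O(r^2)$ with coefficients real analytic near $\mathbb{T}^d$ satisfies $H(\theta,r+\partial_\theta f(\theta,r))=N_H(r)$. *)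

(* Defs.v *)
From Stdlib Require Import Reals ZArith List.
From Coquelicot Require Import Coquelicot.
Import ListNotations.
Open Scope R_scope.

(* Points of R^d, C^d, Z^d, N^d are represented as functions on nat of which
   only the coordinates 0 .. d-1 are used. *)
Definition vecR := nat -> R.
Definition vecC := nat -> C.

Fixpoint rsum (n : nat) (f : nat -> R) : R :=
  match n with O => 0 | S m => rsum m f + f m end.
Fixpoint rprod (n : nat) (f : nat -> R) : R :=
  match n with O => 1 | S m => rprod m f * f m end.
Fixpoint nsum (n : nat) (f : nat -> nat) : nat :=
  match n with O => O | S m => (nsum m f + f m)%nat end.

Definition upd {T : Type} (x : nat -> T) (i : nat) (t : T) : nat -> T :=
  fun k => if Nat.eq_dec k i then t else x k.

Definition dot (d : nat) (w r : vecR) : R := rsum d (fun i => w i * r i).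
Definition normd (d : nat) (r : vecR) : R := sqrt (rsum d (fun i => r i ^ 2)).

Definition dotZ (d : nat) (w : vecR) (k : nat -> Z) : R :=
  rsum d (fun i => w i * IZR (k i)).
Fixpoint maxnormZ (d : nat) (k : nat -> Z) : R :=
  match d with O => 0 | S m => Rmax (maxnormZ m k) (IZR (Z.abs (k m))) end.
Definition nonzeroZ (d : nat) (k : nat -> Z) : Prop :=
  exists i, (i < d)%nat /\ k i <> 0%Z.

Definition nonresonant (d : nat) (w : vecR) : Prop :=
  forall k : nat -> Z, nonzeroZ d k -> dotZ d w k <> 0.

Definition close_d (d : nat) (z z' : vecC) (delta : R) : Prop :=
  forall i, (i < d)%nat -> Cmod (Cminus (z' i) (z i)) < delta.

Definition cderiv_ex (f : C -> C) (x : C) : Prop :=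
  @ex_derive C_AbsRing C_NormedModule f x.

Definition holomorphic2 (d : nat) (U : vecC -> vecC -> Prop)
    (F : vecC -> vecC -> C) : Prop :=
  (forall z w, U z w -> forall eps, 0 < eps -> exists delta, 0 < delta /\
     forall z' w', U z' w' -> close_d d z z' delta -> close_d d w w' delta ->
       Cmod (Cminus (F z' w') (F z w)) < eps) /\
  (forall z w i, (i < d)%nat -> U z w ->
       cderiv_ex (fun t => F (upd z i t) w) (z i)) /\
  (forall z w i, (i < d)%nat -> U z w ->
       cderiv_ex (fun t => F z (upd w i t)) (w i)).

Definition holomorphic1 (d : nat) (U : vecC -> Prop) (F : vecC -> C) : Prop :=
  (forall z, U z -> forall eps, 0 < eps -> exists delta, 0 < delta /\
     forall z', U z' -> close_d d z z' delta -> Cmod (Cminus (F z') (F z)) < eps) /\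
  (forall z i, (i < d)%nat -> U z -> cderiv_ex (fun t => F (upd z i t)) (z i)).

Definition agree {T : Type} (d : nat) (x y : nat -> T) : Prop :=
  forall i, (i < d)%nat -> x i = y i.

Definition toC (x : vecR) : vecC := fun i => RtoC (x i).

(* H : T^d x R^d -> R is real entire: it extends holomorphically to
   (C/Z)^d x C^d (F depends on the first d coordinates only, is 1-periodic in
   each angle, holomorphic everywhere, and equals H on real arguments). *)
Definition real_entire (d : nat) (H : vecR -> vecR -> R) : Prop :=
  exists F : vecC -> vecC -> C,
    (forall z z' w w', agree d z z' -> agree d w w' -> F z w = F z' w') /\
    (forall z w i, (i < d)%nat -> F (upd z i (Cplus (z i) (RtoC 1))) w = F z w) /\
    holomorphic2 d (fun _ _ => True) F /\
    (forall th r, F (toC th) (toC r) = RtoC (H th r)).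

Definition real_analytic_T (d : nat) (a : vecR -> R) : Prop :=
  exists sigma, 0 < sigma /\ exists A : vecC -> C,
    (forall z z', agree d z z' -> A z = A z') /\
    (forall z i, (i < d)%nat -> A (upd z i (Cplus (z i) (RtoC 1))) = A z) /\
    holomorphic1 d (fun z => forall i, (i < d)%nat -> Rabs (Im (z i)) < sigma) A /\
    (forall th, A (toC th) = RtoC (a th)).

Definition linear_plus_O2 (d : nat) (w : vecR) (H : vecR -> vecR -> R) : Prop :=
  exists C0 delta, 0 < delta /\ forall th r, normd d r < delta ->
    Rabs (H th r - dot d w r) <= C0 * (normd d r) ^ 2.

Fixpoint mindices (d N : nat) : list (nat -> nat) :=
  match d with
  | O => [fun _ => O]
  | S d' => flat_map (fun k => map (fun j => upd j d' k) (mindices d' (N - k)))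
                     (seq 0 (S N))
  end.

Definition lsum {T : Type} (l : list T) (F : T -> R) : R :=
  fold_right (fun j acc => F j + acc) 0 l.

Definition mono (d : nat) (r : vecR) (j : nat -> nat) : R :=
  rprod d (fun i => r i ^ j i).

Definition dth (f : vecR -> R) (i : nat) (th : vecR) : R :=
  Derive (fun t => f (upd th i t)) (th i).

(* i-th component of d_theta f_N(theta, r), where f_N is the truncation at
   order N of the formal series f = sum_j a_j(theta) r^j *)
Definition dth_trunc (d N : nat) (a : (nat -> nat) -> vecR -> R)
    (i : nat) (th r : vecR) : R :=
  lsum (mindices d N) (fun j => dth (a j) i th * mono d r j).

(* N(r) = <omega, r> is the Birkhoff normal form of H at T_0: there is a formal
   series f = sum_j a_j(theta) r^j = O(r^2) with real analytic coefficients
   such that H(theta, r + d_theta f(theta, r)) = <omega, r> as formal power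
   series in r (equality of formal series is expressed order by order: for
   every N the truncations agree up to O(|r|^(N+1)), for every theta). *)
Definition bnf_is_linear (d : nat) (w : vecR) (H : vecR -> vecR -> R) : Prop :=
  exists a : (nat -> nat) -> vecR -> R,
    (forall j, real_analytic_T d (a j)) /\
    (forall j, (nsum d j <= 1)%nat -> forall th, a j th = 0) /\
    (forall (N : nat) (th : vecR), exists C0 delta, 0 < delta /\
       forall r, normd d r < delta ->
         Rabs (H th (fun i => r i + dth_trunc d N a i th r) - dot d w r)
           <= C0 * (normd d r) ^ (S N)).

Definition dr (H : vecR -> vecR -> R) (i : nat) (th r : vecR) : R :=
  Derive (fun t => H th (upd r i t)) (r i).
Definition dt (H : vecR -> vecR -> R) (i : nat) (th r : vecR) : R :=
  Derive (fun t => H (upd th i t) r) (th i).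

Definition ham_traj (d : nat) (H : vecR -> vecR -> R) (Th Rr : R -> vecR) (t : R) : Prop :=
  forall s, 0 <= s <= t -> forall i, (i < d)%nat ->
    is_derive (fun u => Th u i) s (dr H i (Th s) (Rr s)) /\
    is_derive (fun u => Rr u i) s (- dt H i (Th s) (Rr s)).

(* the set { t > 0 : exists theta, |r'| <= r, dist(Phi^t_H(theta, r'), T_0) = 1/r } ;
   dist((theta, rho), T_0) = |rho| *)
Definition hit_times (d : nat) (H : vecR -> vecR -> R) (r : R) (t : R) : Prop :=
  0 < t /\ exists th r0 : vecR, normd d r0 <= r /\
    exists Th Rr : R -> vecR, Th 0 = th /\ Rr 0 = r0 /\ ham_traj d H Th Rr t /\
      normd d (Rr t) = / r.

Definition Tdiff (d : nat) (H : vecR -> vecR -> R) (r : R) : R :=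
  real (Glb_Rbar (hit_times d H r)).

Definition diffusive (d : nat) (H : vecR -> vecR -> R) : Prop :=
  exists r0, 0 < r0 /\ forall r, 0 < r < r0 -> exists t, hit_times d H r t.

(* Main.v *)
(** The Hamiltonian is H(θ,r) = <ω,r> + sum_j ρ_j r_d^(m_j) cos(2π<k_j,θ>), where the k_j are
    resonances of the first d-1 frequencies only. Since H does not depend on θ_d, r_d is a first
    integral, the first d-1 angles move linearly, and the other actions are explicit sums of
    primitives of sines: the flow is solved in closed form. The ρ_j decay superexponentially in
    |k_j|, which makes H entire, while the small divisor λ_j = <ω,k_j> is much smaller still,
    16|λ_j| <= ρ_j^(m_j+2), and ρ_(j+1) is much smaller than |λ_j|. On the level r_d = ρ_n
    the n-th mode is still frozen at time ρ_n^-(m_n+2) and pushes the orbit linearly to distance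
    1/ρ_n; the earlier modes have oscillated and averaged out, the later ones are too small
    to matter. With m_j = 2 this gives (b). With m_j = j+2 each power of r_d carries a single
    trigonometric monomial, so the formal solution f = - sum_j ρ_j r_d^(j+2) sin(2π<k_j,θ>)/(2πλ_j)
    of the homological equation has analytic coefficients: the normal form is <ω,r>, and (a) holds. *)

Require Import Defs.
From Stdlib Require Import Reals ZArith List Lra Lia Psatz ClassicalEpsilon.
From Coquelicot Require Import Coquelicot.
Open Scope R_scope.

(** The delicate point is the order of the choices. The hypothesis on the divisors beats every
    exponential exp(-A‖k‖), but A has to be fixed before k. So ρ_j is sought in the form
    exp(-a_j‖k_j‖): the rate a_j comes first, then k_j is picked with ln|λ_j| < -((m_j+2)a_j +
    16)‖k_j‖, and only then ρ_j is a number. Setting a_(j+1) = (j+2)^2 - ln|λ_j| makes ρ_(j+1) small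
    against |λ_j| whatever k_(j+1) turns out to be, because ‖k_(j+1)‖ >= 1. The exponent m_j+2 is a
    travel time: on the level ρ the j-th mode pushes at speed of order ρ^(m_j+1), and the distance
    to cover is 1/ρ. One orbit per n serves a whole range of radii: it starts at distance ρ_n <= r
    and reaches 1/ρ_n >= 1/r, so the intermediate value theorem yields a hit at 1/r. This gives
    diffusivity for every small r and not only along the sequence. All analytic facts reduce to
    summing the majorants |c_j| B^(m_j) exp(L K_j): each derivative or remainder estimate costs a
    larger B or L, which superexponential decay allows. *)

(** * Termwise bounds and termwise differentiation of series *)

Lemma is_series_norm_le {K : AbsRing} {V : NormedModule K} (a : nat -> V) (b : nat -> R)
    (l : V) (s : R) :
  is_series a l -> is_series b s -> (forall n, norm (a n) <= b n) -> norm l <= s.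
Proof.
  intros Ha Hb Hab.
  apply (filterlim_le (F := eventually) (fun n => norm (sum_n a n)) (sum_n b) (norm l) s).
  - exists O. intros n _. apply Rle_trans with (sum_n (fun n => norm (a n)) n).
    + apply norm_sum_n_m.
    + apply sum_n_m_le. exact Hab.
  - apply (filterlim_comp _ _ _ (sum_n a) norm eventually (locally l)).
    + exact Ha.
    + apply filterlim_norm.
  - exact Hb.
Qed.

(* A uniform quadratic remainder avoids any uniform convergence argument, and works alike over R and C. *)
Lemma is_derive_series {K : AbsRing} {V : NormedModule K} (g : nat -> K -> V)
    (g' : nat -> V) (f : K -> V) (D : V) (M : nat -> R) (x : K) :
  (forall t, is_series (fun j => g j t) (f t)) ->
  is_series g' D -> ex_series M ->
  (forall j t, abs (minus t x) < 1 ->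
     norm (minus (minus (g j t) (g j x)) (scal (minus t x) (g' j)))
       <= M j * abs (minus t x) ^ 2) ->
  is_derive f x D.
Proof.
  intros Hf HD [s Hs] HM.
  assert (Hb : forall t, abs (minus t x) < 1 ->
    norm (minus (minus (f t) (f x)) (scal (minus t x) D)) <= s * abs (minus t x) ^ 2).
  { intros t Ht.
    apply (is_series_norm_le
      (fun j => minus (minus (g j t) (g j x)) (scal (minus t x) (g' j)))
      (fun j => M j * abs (minus t x) ^ 2)).
    - refine (is_series_minus _ _ _ _ _ _).
      + refine (is_series_minus _ _ _ _ _ _); apply Hf.
      + refine (is_series_scal _ _ _ _). exact HD.
    - exact (is_series_scal_r _ _ _ Hs).
    - intros j. apply HM, Ht. }
  split.
  - apply is_linear_scal_l.
  - intros x0 Hx0 eps.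
    rewrite <- (is_filter_lim_locally_unique _ _ Hx0). clear x0 Hx0.
    (* The remainder is at most [s] times the squared increment, so an increment below
       [eps / (|s| + 1)] suffices; the added 1 covers [s = 0]. *)
    assert (Hp : 0 < Rmin 1 (eps / (Rabs s + 1))).
    { apply Rmin_pos; [lra|]. apply Rdiv_lt_0_compat. apply cond_pos.
      generalize (Rabs_pos s); lra. }
    exists (mkposreal _ Hp). intros t Ht. change (abs (minus t x) < Rmin 1 (eps / (Rabs s + 1))) in Ht.
    eapply Rle_trans.
    + apply Hb. eapply Rlt_le_trans; [exact Ht|apply Rmin_l].
    + change (norm (minus t x)) with (abs (minus t x)).
      generalize (abs_ge_0 (minus t x)); intro H0.
      replace (s * abs (minus t x) ^ 2) with ((s * abs (minus t x)) * abs (minus t x)) by ring.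
      apply Rmult_le_compat_r; [exact H0|].
      assert (Ht2 : abs (minus t x) < eps / (Rabs s + 1))
        by (eapply Rlt_le_trans; [exact Ht|apply Rmin_r]).
      generalize (Rabs_pos s) (Rle_abs s); intros.
      apply Rle_trans with ((Rabs s + 1) * abs (minus t x)).
      * apply Rmult_le_compat_r; lra.
      * apply Rlt_le. apply Rmult_lt_reg_r with (/ (Rabs s + 1)).
        apply Rinv_0_lt_compat; lra. 
        replace ((Rabs s + 1) * abs (minus t x) * / (Rabs s + 1)) with (abs (minus t x)) by (field; lra).
        exact Ht2.
Qed.

(** * Elementary estimates for exponentials, cosines and powers *)

Definition cexp (z : C) : C := (exp (fst z) * cos (snd z), exp (fst z) * sin (snd z)).

Lemma cexp_plus (z w : C) : cexp (Cplus z w) = Cmult (cexp z) (cexp w).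
Proof.
  unfold cexp, Cplus, Cmult; simpl. rewrite exp_plus, cos_plus, sin_plus.
  f_equal; ring.
Qed.

Lemma Cmod_cexp (z : C) : Cmod (cexp z) = exp (fst z).
Proof.
  unfold cexp, Cmod; simpl.
  replace (_ + _) with (exp (fst z) * exp (fst z) * ((sin (snd z))² + (cos (snd z))²))
    by (unfold Rsqr; ring).
  rewrite sin2_cos2, Rmult_1_r. apply sqrt_square, Rlt_le, exp_pos.
Qed.

Lemma Cmod_cexp_le (z : C) : Cmod (cexp z) <= exp (Cmod z).
Proof.
  rewrite Cmod_cexp. 
  assert (fst z <= Cmod z).
  { eapply Rle_trans. apply Rle_abs. eapply Rle_trans. apply Rmax_l. apply Rmax_Cmod. }
  destruct (Req_dec (fst z) (Cmod z)) as [->|]; [lra|].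
  apply Rlt_le, exp_increasing. lra.
Qed.

Lemma Cmod_le_add (z : C) : Cmod z <= Rabs (fst z) + Rabs (snd z).
Proof.
  unfold Cmod. apply Rsqr_incr_0_var.
  - rewrite Rsqr_sqrt. unfold Rsqr.
    rewrite <- (pow2_abs (fst z)), <- (pow2_abs (snd z)).
    generalize (Rabs_pos (fst z)) (Rabs_pos (snd z)); nra.
    nra.
  - generalize (Rabs_pos (fst z)) (Rabs_pos (snd z)); lra.
Qed.

Lemma exp_le_mono (x y : R) : x <= y -> exp x <= exp y.
Proof. intros [H| ->]; [apply Rlt_le, exp_increasing, H|lra]. Qed.

Lemma exp_ge_1_plus (x : R) : 1 + x <= exp x.
Proof. 
  destruct (Req_dec x 0) as [->|Hx]. rewrite exp_0; lra.
  apply Rlt_le, exp_ineq1, Hx. 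
Qed.

Lemma cos_sub_1_le (y : R) : Rabs (cos y - 1) <= y ^ 2 / 2.
Proof.
  generalize (COS_bound y); intros. rewrite Rabs_left1 by lra.
  replace y with (2 * (y / 2)) by field. rewrite cos_2a_sin.
  assert (Rabs (sin (y/2)) <= Rabs (y/2)).
  { generalize (sin_lt_x); intro.
    destruct (Rtotal_order (y/2) 0) as [Hl|[He|Hg]].
    - rewrite (Rabs_left (y/2)) by lra. rewrite <- Rabs_Ropp, <- sin_neg.
      apply Rabs_le. split. 
      + destruct (Rle_dec (- (y/2)) 1). 
        assert (0 <= sin (-(y/2))) by (apply sin_ge_0; generalize PI_4 PI2_1; lra). lra.
        generalize (SIN_bound (- (y/2))); lra.
      + apply Rlt_le, H0; lra.
    - rewrite He, sin_0; lra.
    - rewrite (Rabs_right (y/2)) by lra.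
      apply Rabs_le. split. 
      + destruct (Rle_dec ((y/2)) 1). 
        assert (0 <= sin ((y/2))) by (apply sin_ge_0; generalize PI_4 PI2_1; lra). lra.
        generalize (SIN_bound ((y/2))); lra.
      + apply Rlt_le, H0; lra. }
  apply Rsqr_le_abs_1 in H0. unfold Rsqr in H0.  lra.
Qed.

(** The mean value theorem writes the difference as (cos c - 1) y with |c| <= |y|, and |cos c - 1|
    <= |c|: from c^2/2 when |c| <= 2, from the trivial bound 2 otherwise. *)
Lemma sin_sub_id_le (y : R) : Rabs (sin y - y) <= y ^ 2.
Proof.
  destruct (MVT_gen (fun y => sin y - y) 0 y (fun c => cos c - 1)) as [c [Hc E]].
  - intros c _. auto_derive; auto. ring.
  - intros c _. apply derivable_continuous_pt.
    exists (cos c - 1). apply is_derive_Reals. auto_derive; auto; ring.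
  - rewrite sin_0 in E. replace (sin y - y) with ((cos c - 1) * y) by lra.
    rewrite Rabs_mult. replace (y ^ 2) with (Rabs y * Rabs y) by (rewrite <- pow2_abs; ring).
    apply Rmult_le_compat_r. apply Rabs_pos.
    assert (Hcy : Rabs c <= Rabs y).
    { revert Hc. unfold Rmin, Rmax. destruct (Rle_dec 0 y); intros.
      - rewrite !Rabs_right; lra. 
      - rewrite !Rabs_left1; lra. }
    apply Rle_trans with (Rabs c); [|exact Hcy].
    generalize (cos_sub_1_le c) (COS_bound c); intros H [H1 H2].
    rewrite <- pow2_abs in H. generalize (Rabs_pos c); intro.
    destruct (Rle_dec (Rabs c) 2). nra. rewrite Rabs_left1; lra.
Qed.

(** Convexity at [- x], multiplied by [exp x], gives exp x - 1 <= x exp x, the upper counterpart of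
    1 + x <= exp x. *)
Lemma exp_sub_1_le (x : R) : Rabs (exp x - 1) <= Rabs x * exp (Rabs x).
Proof.
  generalize (exp_ge_1_plus x) (exp_ge_1_plus (- x)) (exp_pos x); intros H1 H2 H3.
  rewrite exp_Ropp in H2.
  assert (H4 : exp x - 1 <= x * exp x).
  { apply Rmult_le_compat_r with (r := exp x) in H2; [|lra].
    rewrite Rinv_l in H2; lra. }
  destruct (Rle_dec 0 x).
  - rewrite !Rabs_right; lra.
  - generalize (exp_ge_1_plus (-x)). assert (exp x <= 1) by (rewrite <- exp_0; apply exp_le_mono; lra). intro.
    rewrite !Rabs_left1 by lra. nra.
Qed.

Lemma exp_sub_1_sub_id_le (x : R) : Rabs (exp x - 1 - x) <= x ^ 2 * exp (Rabs x).
Proof.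
  generalize (exp_ge_1_plus x) (exp_ge_1_plus (- x)) (exp_pos x); intros H1 H2 H3.
  rewrite exp_Ropp in H2.
  assert (H4 : exp x - 1 <= x * exp x).
  { apply Rmult_le_compat_r with (r := exp x) in H2; [|lra].
    rewrite Rinv_l in H2; lra. }
  rewrite Rabs_right by lra.
  destruct (Rle_dec 0 x).
  - rewrite !Rabs_right; nra.
  - generalize (exp_ge_1_plus (-x)). assert (exp x <= 1) by (rewrite <- exp_0; apply exp_le_mono; lra). intro.
    rewrite !Rabs_left1 by lra. apply Rle_trans with (x ^ 2 * 1); nra.
Qed.

Lemma cexp_quad (h : C) :
  Cmod (Cminus (Cminus (cexp h) (RtoC 1)) h) <= 4 * Cmod h ^ 2 * exp (Cmod h).
Proof.
  destruct h as [x y]. generalize (Rmax_Cmod (x, y)); simpl fst; simpl snd.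
  set (N := Cmod (x, y)). intro HN.
  assert (Hx : Rabs x <= N) by (eapply Rle_trans; [apply Rmax_l|exact HN]).
  assert (Hy : Rabs y <= N) by (eapply Rle_trans; [apply Rmax_r|exact HN]).
  eapply Rle_trans. apply Cmod_le_add.
  unfold cexp, Cminus, Cplus, Copp, RtoC; simpl.
  (* Each real summand is now a product of one-variable remainders. With N the modulus they cost 1,
     1/2, 1 and 1 times N^2 exp N, which fits under the constant 4. *)
  replace (exp x * cos y + - (1) + - x) with ((exp x - 1 - x) + exp x * (cos y - 1)) by ring.
  replace (exp x * sin y + - 0 + - y) with (exp x * (sin y - y) + (exp x - 1) * y) by ring.
  generalize (Rabs_triang (exp x - 1 - x) (exp x * (cos y - 1))).
  generalize (Rabs_triang (exp x * (sin y - y)) ((exp x - 1) * y)).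
  rewrite !Rabs_mult, (Rabs_right (exp x)) by (generalize (exp_pos x); lra).
  intros T1 T2.
  generalize (exp_sub_1_le x) (exp_sub_1_sub_id_le x) (cos_sub_1_le y) (sin_sub_id_le y).
  rewrite <- (pow2_abs x), <- (pow2_abs y). intros B1 B2 B3 B4.
  assert (E1 : exp x <= exp N) by (apply exp_le_mono; eapply Rle_trans; [apply Rle_abs|exact Hx]).
  assert (E2 : exp (Rabs x) <= exp N) by (apply exp_le_mono, Hx).
  assert (Hx2 : Rabs x ^ 2 <= N ^ 2) by (apply pow_incr; split; [apply Rabs_pos|exact Hx]).
  assert (Hy2 : Rabs y ^ 2 <= N ^ 2) by (apply pow_incr; split; [apply Rabs_pos|exact Hy]).
  generalize (Rabs_pos x) (Rabs_pos y) (exp_pos x) (exp_pos (Rabs x)) (exp_pos N); intros.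
  assert (Rabs (exp x - 1 - x) <= N ^ 2 * exp N).
  { eapply Rle_trans. exact B2. apply Rmult_le_compat; try lra. apply pow2_ge_0. }
  assert (exp x * Rabs (cos y - 1) <= exp N * (N ^ 2 / 2)).
  { apply Rmult_le_compat; try lra. apply Rabs_pos. }
  assert (exp x * Rabs (sin y - y) <= exp N * N ^ 2).
  { apply Rmult_le_compat; try lra. apply Rabs_pos. }
  assert (Rabs (exp x - 1) * Rabs y <= (N * exp N) * N).
  { apply Rmult_le_compat; try lra. apply Rabs_pos.
    eapply Rle_trans. exact B1. apply Rmult_le_compat; lra. }
  simpl in *. nra.
Qed.

(** Doubling the exponent pays for one factor |h|, since |h| <= exp |h|; the quadratic remainder
    thus becomes linear in |h|. *)
Lemma cexp_lip (h : C) :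
  Cmod (Cminus (cexp h) (RtoC 1)) <= 5 * Cmod h * exp (2 * Cmod h).
Proof.
  generalize (cexp_quad h) (Cmod_triangle (Cminus (Cminus (cexp h) (RtoC 1)) h) h).
  replace (Cplus (Cminus (Cminus (cexp h) (RtoC 1)) h) h) with (Cminus (cexp h) (RtoC 1)) by ring.
  generalize (Cmod_ge_0 h). set (N := Cmod h). intros H0 H1 H2.
  replace (2 * N) with (N + N) by ring. rewrite exp_plus.
  generalize (exp_ge_1_plus N); intro H3.
  assert (1 * 1 <= exp N * exp N) by (apply Rmult_le_compat; lra).
  assert (N * exp N <= exp N * exp N) by (apply Rmult_le_compat_r; lra).
  simpl in *. nra.
Qed.

Lemma cos_quad (y h : R) : Rabs (cos (y + h) - cos y - h * - sin y) <= 2 * h ^ 2.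
Proof.
  rewrite cos_plus.
  replace (_ - _) with (cos y * (cos h - 1) + - (sin y * (sin h - h))) by ring.
  eapply Rle_trans. apply Rabs_triang. rewrite Rabs_Ropp, !Rabs_mult.
  generalize (cos_sub_1_le h) (sin_sub_id_le h) (Rabs_pos (cos h - 1)) (Rabs_pos (sin h - h)).
  assert (Rabs (cos y) <= 1) by (apply Rabs_le, COS_bound).
  assert (Rabs (sin y) <= 1) by (apply Rabs_le, SIN_bound).
  generalize (Rabs_pos (cos y)) (Rabs_pos (sin y)). intros.
  assert (Rabs (cos y) * Rabs (cos h - 1) <= 1 * (h ^ 2 / 2)) by (apply Rmult_le_compat; lra).
  assert (Rabs (sin y) * Rabs (sin h - h) <= 1 * h ^ 2) by (apply Rmult_le_compat; lra).
  nra.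
Qed.

Lemma cos_lip (x y : R) : Rabs (cos x - cos y) <= Rabs (x - y).
Proof.
  destruct (MVT_gen cos y x (fun c => - sin c)) as [c [Hc E]].
  - intros c _. auto_derive; auto; ring.
  - intros c _. apply continuity_cos.
  - rewrite E, Rabs_mult, Rabs_Ropp. rewrite <- (Rmult_1_l (Rabs (x - y))) at 2.
    apply Rmult_le_compat_r. apply Rabs_pos. apply Rabs_le, SIN_bound.
Qed.

(** In the induction the increment splits as (w+h) times the previous increment plus h w^m. As |w+h|
    <= B - 1, the first part leaves room for exactly one more |h| B^m. *)
Lemma Cpow_lip (w h : C) (B : R) (m : nat) : Cmod w + 2 <= B -> Cmod h <= 1 ->
  Cmod (Cminus (Cpow (Cplus w h) m) (Cpow w m)) <= Cmod h * B ^ m.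
Proof.
  intros HB Hh. generalize (Cmod_ge_0 w) (Cmod_ge_0 h); intros Hw0 Hh0.
  induction m as [|m IH]; simpl.
  - replace (Cminus 1 1) with (RtoC 0) by ring. rewrite Cmod_0. lra.
  - replace (Cminus _ _) with
      (Cplus (Cmult (Cplus w h) (Cminus (Cpow (Cplus w h) m) (Cpow w m))) (Cmult h (Cpow w m))) by ring.
    eapply Rle_trans. apply Cmod_triangle. rewrite !Cmod_mult, Cmod_pow.
    generalize (Cmod_triangle w h); intro.
    assert (Cmod w ^ m <= B ^ m) by (apply pow_incr; lra).
    assert (0 <= Cmod w ^ m) by (apply pow_le; lra).
    assert (Cmod (Cplus w h) * Cmod (Cminus (Cpow (Cplus w h) m) (Cpow w m)) <= (B - 1) * (Cmod h * B ^ m)).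
    { apply Rmult_le_compat; try apply Cmod_ge_0; lra. }
    nra.
Qed.

(** The remainder for m+1 is w times the remainder for m, plus h times the increment bounded by
    [Cpow_lip]. A larger base B takes the place of a factor quadratic in m, in the shape that
    [fast_decay] can sum. *)
Lemma Cpow_quad (w h : C) (B : R) (m : nat) : Cmod w + 2 <= B -> Cmod h <= 1 ->
  Cmod (Cminus (Cminus (Cpow (Cplus w h) m) (Cpow w m))
          (Cmult h (Cmult (INR m) (Cpow w (pred m))))) <= Cmod h ^ 2 * B ^ m.
Proof.
  intros HB Hh. generalize (Cmod_ge_0 w) (Cmod_ge_0 h); intros Hw0 Hh0.
  induction m as [|m IH].
  - simpl. replace (Cminus _ _) with (RtoC 0) by ring. rewrite Cmod_0. nra.
  (* At [m = 0] the exponent [pred m] is 0 rather than -1; the coefficient [INR 0] keeps the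
     identity true. *)
  - assert (E : Cmult w (Cmult (INR m) (Cpow w (pred m))) = Cmult (INR m) (Cpow w m)).
    { destruct m; simpl pred. simpl. ring. rewrite Cpow_S. ring. }
    replace (Cminus _ _) with
      (Cplus (Cmult w (Cminus (Cminus (Cpow (Cplus w h) m) (Cpow w m))
          (Cmult h (Cmult (INR m) (Cpow w (pred m))))))
         (Cmult h (Cminus (Cpow (Cplus w h) m) (Cpow w m)))).
    2:{ simpl pred. rewrite !Cpow_S, S_INR, RtoC_plus.
        replace (Cmult w (Cminus (Cminus (Cpow (Cplus w h) m) (Cpow w m)) (Cmult h (Cmult (INR m) (Cpow w (pred m))))))
        with (Cminus (Cminus (Cmult w (Cpow (Cplus w h) m)) (Cmult w (Cpow w m))) (Cmult h (Cmult w (Cmult (INR m) (Cpow w (pred m)))))) by ring.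
        rewrite E. ring. }
    eapply Rle_trans. apply Cmod_triangle. rewrite !Cmod_mult.
    generalize (Cpow_lip w h B m HB Hh); intro HL.
    assert (Cmod w * Cmod (Cminus (Cminus (Cpow (Cplus w h) m) (Cpow w m))
          (Cmult h (Cmult (INR m) (Cpow w (pred m))))) <= (B - 2) * (Cmod h ^ 2 * B ^ m)).
    { apply Rmult_le_compat; try apply Cmod_ge_0; lra. }
    assert (Cmod h * Cmod (Cminus (Cpow (Cplus w h) m) (Cpow w m)) <= Cmod h * (Cmod h * B ^ m)).
    { apply Rmult_le_compat_l; lra. }
    assert (0 <= Cmod h ^ 2 * B ^ m) by (apply Rmult_le_pos; [apply pow2_ge_0|apply pow_le; lra]).
    simpl in *. nra.
Qed.

(** * Waves: entire trigonometric series *)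

Fixpoint csum (n : nat) (f : nat -> C) : C :=
  match n with O => RtoC 0 | S m => Cplus (csum m f) (f m) end.

Lemma csum_ext (n : nat) (f g : nat -> C) :
  (forall i, (i < n)%nat -> f i = g i) -> csum n f = csum n g.
Proof.
  induction n as [|n IH]; simpl; intros H; [reflexivity|].
  rewrite IH, H by (intros; try apply H; lia). reflexivity.
Qed.

Lemma csum_plus (n : nat) (f g : nat -> C) :
  csum n (fun i => Cplus (f i) (g i)) = Cplus (csum n f) (csum n g).
Proof. induction n as [|n IH]; simpl; [ring|rewrite IH; ring]. Qed.

Lemma csum_upd (n : nat) (z : vecC) (i : nat) (t : C) (a : nat -> C) : (i < n)%nat ->
  csum n (fun l => Cmult (upd z i t l) (a l))
    = Cplus (csum n (fun l => Cmult (z l) (a l))) (Cmult (Cminus t (z i)) (a i)).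
Proof.
  induction n as [|n IH]; intros Hi; [lia|]. simpl.
  destruct (Nat.eq_dec i n) as [->|Hn].
  - rewrite (csum_ext n _ (fun l => Cmult (z l) (a l))).
    + unfold upd. destruct (Nat.eq_dec n n); [ring|lia].
    + intros l Hl. unfold upd. destruct (Nat.eq_dec l n); [lia|reflexivity].
  - rewrite IH by lia. unfold upd at 1. destruct (Nat.eq_dec n i); [lia|ring].
Qed.

Lemma csum_le (n : nat) (f : nat -> C) (B : R) :
  (forall i, (i < n)%nat -> Cmod (f i) <= B) -> Cmod (csum n f) <= INR n * B.
Proof.
  induction n as [|n IH]; intros H.
  - simpl. rewrite Cmod_0. lra.
  - rewrite S_INR. simpl csum. eapply Rle_trans. apply Cmod_triangle.
    assert (Cmod (csum n f) <= INR n * B) by (apply IH; intros; apply H; lia).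
    assert (Cmod (f n) <= B) by (apply H; lia). lra.
Qed.

Definition phase (d : nat) (k : nat -> Z) (z : vecC) : C :=
  csum d (fun i => Cmult (z i) (RtoC (IZR (k i)))).

Definition mode (d : nat) (k : nat -> Z) (z : vecC) : C :=
  cexp (Cmult (0, 2 * PI) (phase d k z)).

(** The integer 8 stands for 2π in all majorants below, from PI <= 4. *)
Lemma Cmod_2pi (z : C) : Cmod (Cmult (0, 2 * PI) z) <= 8 * Cmod z.
Proof.
  rewrite Cmod_mult. apply Rmult_le_compat_r. apply Cmod_ge_0.
  eapply Rle_trans. apply Cmod_le_add. simpl.
  rewrite Rabs_R0, Rabs_right; generalize PI_4 PI_RGT_0; lra.
Qed.

Lemma phase_le (d : nat) (k : nat -> Z) (z : vecC) (Z0 K : R) :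
  (forall i, (i < d)%nat -> Cmod (z i) <= Z0) ->
  (forall i, (i < d)%nat -> Rabs (IZR (k i)) <= K) ->
  Cmod (phase d k z) <= INR d * (Z0 * K).
Proof.
  intros Hz Hk. apply csum_le. intros i Hi. rewrite Cmod_mult, Cmod_R.
  apply Rmult_le_compat; auto using Cmod_ge_0, Rabs_pos.
Qed.

Lemma mode_le (d : nat) (k : nat -> Z) (z : vecC) (Z0 K : R) :
  (forall i, (i < d)%nat -> Cmod (z i) <= Z0) ->
  (forall i, (i < d)%nat -> Rabs (IZR (k i)) <= K) ->
  Cmod (mode d k z) <= exp (8 * INR d * Z0 * K).
Proof.
  intros Hz Hk. eapply Rle_trans. apply Cmod_cexp_le. apply exp_le_mono.
  eapply Rle_trans. apply Cmod_2pi. generalize (phase_le d k z Z0 K Hz Hk). lra.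
Qed.

Lemma mode_shift (d : nat) (k : nat -> Z) (z z' : vecC) (h : C) :
  phase d k z' = Cplus (phase d k z) h ->
  mode d k z' = Cmult (mode d k z) (cexp (Cmult (0, 2 * PI) h)).
Proof.
  intros H. unfold mode. rewrite H, <- cexp_plus. f_equal. ring.
Qed.

(** A mode is a character, so the difference is the mode at z times exp(2πih) - 1, with h the phase
    of z' - z. With X = 8dK, the linear factor δX is at most δ exp X and [cexp_lip] costs exp(2X):
    hence the 3 added to [Z0]. *)
Lemma mode_lip (d : nat) (k : nat -> Z) (z z' : vecC) (Z0 K delta : R) : 0 <= K ->
  (forall i, (i < d)%nat -> Cmod (z i) <= Z0) ->
  (forall i, (i < d)%nat -> Rabs (IZR (k i)) <= K) ->
  0 <= delta <= 1 -> (forall i, (i < d)%nat -> Cmod (Cminus (z' i) (z i)) <= delta) ->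
  Cmod (Cminus (mode d k z') (mode d k z)) <= 5 * delta * exp (8 * INR d * (Z0 + 3) * K).
Proof.
  intros HK0 Hz Hk Hd Hzz.
  set (h := phase d k (fun i => Cminus (z' i) (z i))).
  assert (Hh : Cmod h <= INR d * (delta * K)) by (apply phase_le; auto).
  rewrite (mode_shift d k z z' h).
  2:{ unfold h, phase. rewrite <- csum_plus. apply csum_ext. intros; ring. }
  replace (Cminus _ _) with (Cmult (mode d k z) (Cminus (cexp (Cmult (0, 2 * PI) h)) (RtoC 1))) by ring.
  rewrite Cmod_mult.
  generalize (mode_le d k z Z0 K Hz Hk) (cexp_lip (Cmult (0, 2 * PI) h)) (Cmod_2pi h).
  set (g := Cmult (0, 2 * PI) h). set (X := 8 * INR d * K). intros H1 H2 H3.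
  assert (HX : 0 <= X) by (unfold X; generalize (pos_INR d); nra).
  assert (Hg : Cmod g <= delta * X) by (unfold X; lra).
  assert (Hg1 : Cmod g <= X) by nra.
  replace (8 * INR d * (Z0 + 3) * K) with (8 * INR d * Z0 * K + (X + 2 * X)) by (unfold X; ring).
  rewrite !exp_plus.
  replace (5 * delta * _) with
    (exp (8 * INR d * Z0 * K) * ((5 * (delta * exp X)) * exp (2 * X))) by ring.
  apply Rmult_le_compat; auto using Cmod_ge_0.
  eapply Rle_trans. exact H2. generalize (Cmod_ge_0 g) (exp_ge_1_plus X); intros.
  apply Rmult_le_compat. lra. apply Rlt_le, exp_pos.
  apply Rmult_le_compat_l. lra. apply Rle_trans with (1 := Hg). apply Rmult_le_compat_l; lra.
  apply exp_le_mono; lra.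
Qed.

(** The same factorisation as for [mode_lip], now with [cexp_quad]. The square of the increment
    contributes exp(2X) and the exponential factor another exp X, so [Z0 + 3] appears again. *)
Lemma mode_quad (d : nat) (k : nat -> Z) (z : vecC) (Z0 K : R) (i : nat) (t : C) :
  0 <= K -> (i < d)%nat ->
  (forall i, (i < d)%nat -> Cmod (z i) <= Z0) ->
  (forall i, (i < d)%nat -> Rabs (IZR (k i)) <= K) ->
  Cmod (Cminus t (z i)) <= 1 ->
  Cmod (Cminus (Cminus (mode d k (upd z i t)) (mode d k z))
     (Cmult (Cminus t (z i)) (Cmult (0, 2 * PI) (Cmult (IZR (k i)) (mode d k z)))))
   <= Cmod (Cminus t (z i)) ^ 2 * (4 * exp (8 * INR d * (Z0 + 3) * K)).
Proof.
  intros HK0 Hi Hz Hk Ht. set (s := Cminus t (z i)) in *.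
  rewrite (mode_shift d k z _ (Cmult s (IZR (k i)))) by (apply csum_upd, Hi).
  set (h := Cmult (0, 2 * PI) (Cmult s (IZR (k i)))).
  replace (Cminus _ _) with (Cmult (mode d k z) (Cminus (Cminus (cexp h) (RtoC 1)) h))
    by (unfold h; ring).
  rewrite Cmod_mult.
  generalize (mode_le d k z Z0 K Hz Hk) (cexp_quad h) (Cmod_2pi (Cmult s (IZR (k i)))).
  fold h. rewrite Cmod_mult, Cmod_R. set (X := 8 * INR d * K). intros H1 H2 H3.
  assert (Hd1 : 1 <= INR d) by (apply (le_INR 1); lia).
  generalize (Cmod_ge_0 s) (Cmod_ge_0 h); intros.
  assert (HX : 8 * K <= X) by (unfold X; nra).
  assert (Hg : Cmod h <= Cmod s * X).
  { apply Rle_trans with (1 := H3). generalize (Hk i Hi); intro.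
    assert (Cmod s * Rabs (IZR (k i)) <= Cmod s * K) by (apply Rmult_le_compat_l; lra).
    assert (Cmod s * (8 * K) <= Cmod s * X) by (apply Rmult_le_compat_l; lra). lra. }
  assert (Hg1 : Cmod h <= X) by nra.
  replace (8 * INR d * (Z0 + 3) * K) with (8 * INR d * Z0 * K + (X + X + X)) by (unfold X; ring).
  rewrite !exp_plus.
  replace (Cmod s ^ 2 * _) with
    (exp (8 * INR d * Z0 * K) * (4 * (Cmod s * exp X) ^ 2 * exp X)) by ring.
  apply Rmult_le_compat; auto using Cmod_ge_0.
  apply Rle_trans with (1 := H2). generalize (exp_ge_1_plus X); intros.
  apply Rmult_le_compat. generalize (pow2_ge_0 (Cmod h)); lra. apply Rlt_le, exp_pos.
  apply Rmult_le_compat_l. lra. apply pow_incr. split; auto.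
  apply Rle_trans with (1 := Hg). apply Rmult_le_compat_l; lra.
  apply exp_le_mono; lra.
Qed.

(** Summing the two parts separately gives a total operation, and makes the first component of a
    wave a real [Series] by mere unfolding. *)
Definition cseries (a : nat -> C) : C :=
  (Series (fun j => fst (a j)), Series (fun j => snd (a j))).

Lemma ex_series_dominated (a b : nat -> R) :
  (forall n, Rabs (a n) <= b n) -> ex_series b -> ex_series a.
Proof. exact (@ex_series_le R_AbsRing R_CompleteNormedModule a b). Qed.

Lemma is_series_cseries (a : nat -> C) (b : nat -> R) :
  (forall j, Cmod (a j) <= b j) -> ex_series b ->
  @is_series C_AbsRing C_NormedModule a (cseries a).
Proof.
  intros Hab Hb.
  assert (H1 : is_series (fun j => fst (a j)) (Series (fun j => fst (a j)))).
  { apply Series_correct, ex_series_dominated with b; auto. intros n.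
    eapply Rle_trans; [apply Rmax_l|eapply Rle_trans; [apply Rmax_Cmod|apply Hab]]. }
  assert (H2 : is_series (fun j => snd (a j)) (Series (fun j => snd (a j)))).
  { apply Series_correct, ex_series_dominated with b; auto. intros n.
    eapply Rle_trans; [apply Rmax_r|eapply Rle_trans; [apply Rmax_Cmod|apply Hab]]. }
  unfold is_series in *.
  apply filterlim_ext with (fun n => (sum_n (fun j => fst (a j)) n, sum_n (fun j => snd (a j)) n)).
  { intros n. induction n as [|n IH].
    - rewrite !sum_O. symmetry; apply surjective_pairing.
    - rewrite !sum_Sn, <- IH. reflexivity. }
  intros P [eps HP]. 
  generalize (H1 _ (locally_ball _ eps)) (H2 _ (locally_ball _ eps)).
  intros [n1 Hn1] [n2 Hn2]. exists (max n1 n2). intros n Hn. apply HP.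
  split; [apply Hn1|apply Hn2]; lia.
Qed.

(** The coefficients are complex and the exponents arbitrary so that the class is closed under
    differentiation: an angle derivative changes only [c], a derivative in the last action only [c]
    and [m]. Hamilton's equations therefore stay inside the class. *)
Definition wave (d : nat) (c : nat -> C) (m : nat -> nat) (k : nat -> nat -> Z)
    (z w : vecC) : C :=
  cseries (fun j => Cmult (Cmult (c j) (Cpow (w (pred d)) (m j))) (mode d (k j) z)).

(* [K j] bounds the frequencies of [k j]; the growth [B ^ m j * exp (L * K j)] covers the size of
   the j-th term on any bounded set of complex arguments. *)
Definition fast_decay (d : nat) (c : nat -> C) (m : nat -> nat) (k : nat -> nat -> Z)
    (K : nat -> R) : Prop :=
  (forall j, 0 <= K j) /\
  (forall j i, (i < d)%nat -> Rabs (IZR (k j i)) <= K j) /\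
  (forall B L, 1 <= B -> 0 <= L -> ex_series (fun j => Cmod (c j) * B ^ m j * exp (L * K j))).

Lemma bounded_vec (d : nat) (z : vecC) : exists Z0, 0 <= Z0 /\ forall i, (i < d)%nat -> Cmod (z i) <= Z0.
Proof.
  induction d as [|d [Z0 [H0 H]]].
  - exists 0. split; [lra|intros; lia].
  - exists (Rmax Z0 (Cmod (z d))). split.
    + eapply Rle_trans; [exact H0|apply Rmax_l].
    + intros i Hi. destruct (Nat.eq_dec i d) as [->|]. apply Rmax_r.
      eapply Rle_trans; [apply H; lia|apply Rmax_l].
Qed.

Lemma wave_is_series (d : nat) (c : nat -> C) (m : nat -> nat) (k : nat -> nat -> Z)
    (K : nat -> R) (z w : vecC) :
  fast_decay d c m k K ->
  @is_series C_AbsRing C_NormedModule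
    (fun j => Cmult (Cmult (c j) (Cpow (w (pred d)) (m j))) (mode d (k j) z)) (wave d c m k z w).
Proof.
  intros (HK & Hk & HS). destruct (bounded_vec d z) as [Z0 [HZ0 HZ]].
  apply is_series_cseries with
    (fun j => Cmod (c j) * (Cmod (w (pred d)) + 1) ^ m j * exp (8 * INR d * Z0 * K j)).
  - intros j. rewrite !Cmod_mult, Cmod_pow.
    generalize (Cmod_ge_0 (w (pred d))) (Cmod_ge_0 (c j)); intros.
    apply Rmult_le_compat; try apply Cmod_ge_0.
    + apply Rmult_le_pos; [lra|apply pow_le; lra].
    + apply Rmult_le_compat_l; [lra|]. apply pow_incr; lra.
    + apply mode_le; auto.
  - apply HS. generalize (Cmod_ge_0 (w (pred d))); lra.
    generalize (pos_INR d); nra.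
Qed.

(** The new factor 2π|k_i| is at most 8 exp K, which is absorbed by passing from L to L + 1. *)
Lemma fast_decay_angle (d : nat) (c : nat -> C) (m : nat -> nat) (k : nat -> nat -> Z)
    (K : nat -> R) (i : nat) : (i < d)%nat -> fast_decay d c m k K ->
  fast_decay d (fun j => Cmult (Cmult (0, 2 * PI) (IZR (k j i))) (c j)) m k K.
Proof.
  intros Hi (HK & Hk & HS). split; [exact HK|split; [exact Hk|]]. intros B L HB HL.
  apply ex_series_dominated with (fun j => 8 * (Cmod (c j) * B ^ m j * exp ((L + 1) * K j))).
  2:{ refine (ex_series_scal_l _ _ _). apply HS; lra. }
  intros j.
  assert (0 < B ^ m j) by (apply pow_lt; lra).
  generalize (exp_pos (L * K j)) (Cmod_ge_0 (c j)); intros.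
  rewrite Rabs_right.
  2:{ apply Rle_ge. repeat apply Rmult_le_pos; try lra. apply Cmod_ge_0. }
  rewrite Cmod_mult. generalize (Cmod_2pi (IZR (k j i))). rewrite Cmod_R. intros H2.
  generalize (Hk j i Hi) (exp_ge_1_plus (K j)); intros.
  replace ((L + 1) * K j) with (K j + L * K j) by ring. rewrite exp_plus.
  apply Rle_trans with (8 * exp (K j) * Cmod (c j) * B ^ m j * exp (L * K j)); [|lra].
  repeat (apply Rmult_le_compat_r; [lra|]). lra.
Qed.

Lemma INR_le_pow2 (n : nat) : INR n <= 2 ^ n.
Proof.
  induction n as [|n IH]; [simpl; lra|]. rewrite S_INR. simpl.
  assert (1 <= 2 ^ n) by (apply pow_R1_Rle; lra). lra.
Qed.

(** The new factor m is at most 2^m, which is absorbed by passing from B to 2B. *)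
Lemma fast_decay_action (d : nat) (c : nat -> C) (m : nat -> nat) (k : nat -> nat -> Z)
    (K : nat -> R) : fast_decay d c m k K ->
  fast_decay d (fun j => Cmult (INR (m j)) (c j)) (fun j => pred (m j)) k K.
Proof.
  intros (HK & Hk & HS). split; [exact HK|split; [exact Hk|]]. intros B L HB HL.
  apply ex_series_dominated with (fun j => Cmod (c j) * (2 * B) ^ m j * exp (L * K j)).
  2:{ apply HS; lra. }
  intros j.
  assert (0 < B ^ pred (m j)) by (apply pow_lt; lra).
  generalize (exp_pos (L * K j)) (Cmod_ge_0 (c j)); intros.
  rewrite Rabs_right.
  2:{ apply Rle_ge. repeat apply Rmult_le_pos; try lra. apply Cmod_ge_0. }
  rewrite Cmod_mult, Cmod_R, Rabs_right by (apply Rle_ge, pos_INR).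
  apply Rmult_le_compat_r; [lra|].
  rewrite Rpow_mult_distr, (Rmult_comm (INR _)), Rmult_assoc. apply Rmult_le_compat_l; [lra|].
  apply Rmult_le_compat; [apply pos_INR|lra|apply INR_le_pow2|].
  apply Rle_pow; [lra|lia].
Qed.

Lemma wave_deriv_angle (d : nat) (c : nat -> C) (m : nat -> nat) (k : nat -> nat -> Z)
    (K : nat -> R) (z w : vecC) (i : nat) : (i < d)%nat -> fast_decay d c m k K ->
  @is_derive C_AbsRing C_NormedModule (fun t => wave d c m k (upd z i t) w) (z i)
    (wave d (fun j => Cmult (Cmult (0, 2 * PI) (IZR (k j i))) (c j)) m k z w).
Proof.
  intros Hi HF. generalize (fun z => wave_is_series d c m k K z w HF).
  generalize (wave_is_series d _ m k K z w (fast_decay_angle d c m k K i Hi HF)).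
  intros HD Hf.
  destruct HF as (HK & Hk & HS). destruct (bounded_vec d z) as [Z0 [HZ0 HZ]].
  apply (is_derive_series (K := C_AbsRing) (V := C_NormedModule)
    (fun j t => Cmult (Cmult (c j) (Cpow (w (pred d)) (m j))) (mode d (k j) (upd z i t)))
    (fun j => Cmult (Cmult (Cmult (Cmult (0, 2 * PI) (IZR (k j i))) (c j)) (Cpow (w (pred d)) (m j))) (mode d (k j) z))
    _ _ (fun j => 4 * (Cmod (c j) * (Cmod (w (pred d)) + 1) ^ m j * exp (8 * INR d * (Z0 + 3) * K j)))).
  - intros t. apply Hf.
  - exact HD.
  - refine (ex_series_scal_l _ _ _). apply HS. generalize (Cmod_ge_0 (w (pred d))); lra.
    generalize (pos_INR d); nra.
  - intros j t Ht.
    change (Cmod (Cminus t (z i)) < 1) in Ht. change (abs (minus t (z i))) with (Cmod (Cminus t (z i))).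
    assert (Hz : mode d (k j) (upd z i (z i)) = mode d (k j) z).
    { unfold mode, phase. do 2 f_equal. apply csum_ext. intros l Hl. unfold upd.
      destruct (Nat.eq_dec l i) as [->|]; reflexivity. }
    rewrite Hz. change (norm ?x) with (Cmod x).
    change (Cmod (Cminus (Cminus (c j * w (pred d) ^ m j * mode d (k j) (upd z i t))%C
       (c j * w (pred d) ^ m j * mode d (k j) z)%C)
       (Cmult (Cminus t (z i)) ((0, (2 * PI)%R) * IZR (k j i) * c j * w (pred d) ^ m j * mode d (k j) z)%C))
       <= 4 * (Cmod (c j) * (Cmod (w (pred d)) + 1) ^ m j * exp (8 * INR d * (Z0 + 3) * K j)) * Cmod (t - z i) ^ 2).
    replace (Cminus _ _) with (Cmult (Cmult (c j) (Cpow (w (pred d)) (m j)))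
      (Cminus (Cminus (mode d (k j) (upd z i t)) (mode d (k j) z))
       (Cmult (Cminus t (z i)) (Cmult (0, 2 * PI) (Cmult (IZR (k j i)) (mode d (k j) z)))))) by ring.
    rewrite !Cmod_mult, Cmod_pow.
    replace (4 * _ * _) with (Cmod (c j) * (Cmod (w (pred d)) + 1) ^ m j *
       (Cmod (t - z i) ^ 2 * (4 * exp (8 * INR d * (Z0 + 3) * K j)))) by ring.
    generalize (Cmod_ge_0 (w (pred d))) (Cmod_ge_0 (c j)); intros.
    apply Rmult_le_compat; try apply Cmod_ge_0.
    + apply Rmult_le_pos; [lra|apply pow_le; lra].
    + apply Rmult_le_compat_l; [lra|]. apply pow_incr; lra.
    + apply mode_quad; auto. lra.
Qed.

Lemma wave_agree (d : nat) (c : nat -> C) (m : nat -> nat) (k : nat -> nat -> Z) (z z' w w' : vecC) :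
  agree d z z' -> w (pred d) = w' (pred d) -> wave d c m k z w = wave d c m k z' w'.
Proof.
  intros Hz Hw. unfold wave.
  assert (H : forall j, mode d (k j) z = mode d (k j) z').
  { intros j. unfold mode, phase. do 2 f_equal. apply csum_ext. intros l Hl. rewrite Hz; auto. }
  unfold cseries. f_equal; apply Series_ext; intros j; rewrite Hw, H; reflexivity.
Qed.

Lemma wave_deriv_action (d : nat) (c : nat -> C) (m : nat -> nat) (k : nat -> nat -> Z)
    (K : nat -> R) (z w : vecC) : fast_decay d c m k K ->
  @is_derive C_AbsRing C_NormedModule (fun t => wave d c m k z (upd w (pred d) t)) (w (pred d))
    (wave d (fun j => Cmult (INR (m j)) (c j)) (fun j => pred (m j)) k z w).
Proof.
  intros HF. generalize (fun w => wave_is_series d c m k K z w HF).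
  generalize (wave_is_series d _ _ k K z w (fast_decay_action d c m k K HF)).
  intros HD Hf.
  destruct HF as (HK & Hk & HS). destruct (bounded_vec d z) as [Z0 [HZ0 HZ]].
  assert (Hu : forall t, upd w (pred d) t (pred d) = t).
  { intros t. unfold upd. destruct (Nat.eq_dec (pred d) (pred d)); [reflexivity|lia]. }
  apply (is_derive_series (K := C_AbsRing) (V := C_NormedModule)
    (fun j t => Cmult (Cmult (c j) (Cpow t (m j))) (mode d (k j) z))
    (fun j => Cmult (Cmult (Cmult (INR (m j)) (c j)) (Cpow (w (pred d)) (pred (m j)))) (mode d (k j) z))
    _ _ (fun j => Cmod (c j) * (Cmod (w (pred d)) + 2) ^ m j * exp (8 * INR d * Z0 * K j))).
  - intros t. generalize (Hf (upd w (pred d) t)). rewrite Hu. auto.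
  - exact HD.
  - apply HS. generalize (Cmod_ge_0 (w (pred d))); lra.
    generalize (pos_INR d); nra.
  - intros j t Ht. change C in t. set (u := w (pred d)) in *.
    change (Cmod (Cminus t u) < 1) in Ht. change (abs (minus t u)) with (Cmod (Cminus t u)).
    change (Cmod (Cminus (Cminus (c j * t ^ m j * mode d (k j) z)%C
       (c j * u ^ m j * mode d (k j) z)%C)
       (Cmult (Cminus t u) (INR (m j) * c j * u ^ pred (m j) * mode d (k j) z)%C))
       <= Cmod (c j) * (Cmod u + 2) ^ m j * exp (8 * INR d * Z0 * K j) * Cmod (t - u) ^ 2).
    generalize (Cpow_quad u (Cminus t u) (Cmod u + 2) (m j) ltac:(lra) ltac:(lra)).
    replace (Cplus u (Cminus t u)) with t by ring. intro HQ.
    replace (Cminus _ _) with (Cmult (Cmult (c j) (mode d (k j) z))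
      (Cminus (Cminus (Cpow t (m j)) (Cpow u (m j)))
        (Cmult (Cminus t u) (Cmult (INR (m j)) (Cpow u (pred (m j))))))) by ring.
    rewrite !Cmod_mult.
    replace (_ * _ * _ * _) with (Cmod (c j) * exp (8 * INR d * Z0 * K j) *
        (Cmod (t - u) ^ 2 * (Cmod u + 2) ^ m j)) by ring.
    apply Rmult_le_compat; try apply Cmod_ge_0; auto.
    + apply Rmult_le_pos; apply Cmod_ge_0.
    + apply Rmult_le_compat_l. apply Cmod_ge_0. apply mode_le; auto.
Qed.

Lemma wave_continuous (d : nat) (c : nat -> C) (m : nat -> nat) (k : nat -> nat -> Z)
    (K : nat -> R) (z w : vecC) (eps : R) : (0 < d)%nat -> fast_decay d c m k K -> 0 < eps ->
  exists delta, 0 < delta /\ forall z' w', close_d d z z' delta -> close_d d w w' delta ->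
    Cmod (Cminus (wave d c m k z' w') (wave d c m k z w)) < eps.
Proof.
  intros Hd HF He. generalize (fun z w => wave_is_series d c m k K z w HF). intros Hf.
  destruct HF as (HK & Hk & HS). destruct (bounded_vec d z) as [Z0 [HZ0 HZ]].
  set (u := w (pred d)).
  destruct (HS (Cmod u + 2) (8 * INR d * (Z0 + 3))) as [M HM].
  { generalize (Cmod_ge_0 u); lra. } { generalize (pos_INR d); nra. }
  assert (HM0 : 0 <= M).
  { apply Rle_trans with (Rabs M); [apply Rabs_pos|].
    apply (is_series_norm_le (K := R_AbsRing) (V := R_NormedModule) _ _ _ _ HM HM).
    intros n. change (norm ?x) with (Rabs x). rewrite Rabs_right; [lra|]. apply Rle_ge.
    generalize (Cmod_ge_0 u) (exp_pos (8 * INR d * (Z0 + 3) * K n)); intros.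
    repeat apply Rmult_le_pos; try lra. apply Cmod_ge_0. apply pow_le; lra. }
  (* The constant 6 is 1 + 5: the change of the power costs 1 times [delta], and the change of the
     mode costs 5 times [delta] by [mode_lip]. [M] sums the common majorant. *)
  set (delta := Rmin 1 (eps / (6 * M + 1))).
  assert (Hdp : 0 < delta).
  { apply Rmin_pos; [lra|]. apply Rdiv_lt_0_compat; lra. }
  exists delta. split; [exact Hdp|]. intros z' w' Hz Hw.
  assert (Hd1 : delta <= 1) by apply Rmin_l.
  assert (Hd2 : delta * (6 * M + 1) <= eps).
  { apply Rmult_le_reg_r with (/ (6 * M + 1)). apply Rinv_0_lt_compat; lra.
    rewrite Rmult_assoc, Rinv_r, Rmult_1_r by lra. apply Rmin_r. }
  apply Rle_lt_trans with (6 * delta * M); [|nra].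
  apply (is_series_norm_le (K := C_AbsRing) (V := C_NormedModule)
    (fun j => Cminus (Cmult (Cmult (c j) (Cpow (w' (pred d)) (m j))) (mode d (k j) z'))
                     (Cmult (Cmult (c j) (Cpow (w (pred d)) (m j))) (mode d (k j) z)))
    (fun j => 6 * delta * (Cmod (c j) * (Cmod u + 2) ^ m j * exp (8 * INR d * (Z0 + 3) * K j)))).
  - refine (is_series_minus _ _ _ _ _ _); apply Hf.
  - refine (is_series_scal_l _ _ _ _). exact HM.
  - intros j. change (norm ?x) with (Cmod x).
    fold u. set (u' := w' (pred d)).
    assert (Hu : Cmod (Cminus u' u) < delta) by (apply Hw; lia).
    generalize (Cpow_lip u (Cminus u' u) (Cmod u + 2) (m j) ltac:(lra) ltac:(lra)).
    replace (Cplus u (Cminus u' u)) with u' by ring. intro HP.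
    generalize (mode_lip d (k j) z z' Z0 (K j) delta (HK j) HZ (Hk j) ltac:(lra)
      (fun i Hi => Rlt_le _ _ (Hz i Hi))). intro HL.
    assert (HZ' : forall i, (i < d)%nat -> Cmod (z' i) <= Z0 + 1).
    { intros i Hi. generalize (Hz i Hi) (HZ i Hi) (Cmod_triangle (Cminus (z' i) (z i)) (z i)).
      replace (Cplus (Cminus (z' i) (z i)) (z i)) with (z' i) by ring. lra. }
    generalize (mode_le d (k j) z' (Z0 + 1) (K j) HZ' (Hk j)). intro HB.
    assert (HE : exp (8 * INR d * (Z0 + 1) * K j) <= exp (8 * INR d * (Z0 + 3) * K j)).
    { apply exp_le_mono. apply Rmult_le_compat_r; [apply HK|]. generalize (pos_INR d); nra. }
    set (E := exp (8 * INR d * (Z0 + 3) * K j)) in *.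
    replace (Cminus _ _) with (Cmult (c j) (Cplus (Cmult (Cminus (Cpow u' (m j)) (Cpow u (m j))) (mode d (k j) z'))
       (Cmult (Cpow u (m j)) (Cminus (mode d (k j) z') (mode d (k j) z))))) by ring.
    rewrite Cmod_mult.
    replace (6 * delta * _) with (Cmod (c j) * (6 * delta * ((Cmod u + 2) ^ m j * E))) by ring.
    apply Rmult_le_compat_l; [apply Cmod_ge_0|].
    eapply Rle_trans; [apply Cmod_triangle|]. rewrite !Cmod_mult, Cmod_pow.
    generalize (Cmod_ge_0 u) (Cmod_ge_0 (Cminus u' u)); intros.
    assert (HPw : Cmod u ^ m j <= (Cmod u + 2) ^ m j) by (apply pow_incr; lra).
    assert (0 <= Cmod u ^ m j) by (apply pow_le; lra).
    assert (Cmod (Cminus (Cpow u' (m j)) (Cpow u (m j))) * Cmod (mode d (k j) z')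
      <= (delta * (Cmod u + 2) ^ m j) * E).
    { apply Rmult_le_compat; try apply Cmod_ge_0; try lra.
      apply Rle_trans with (1 := HP). apply Rmult_le_compat_r; lra. }
    assert (Cmod u ^ m j * Cmod (Cminus (mode d (k j) z') (mode d (k j) z))
      <= (Cmod u + 2) ^ m j * (5 * delta * E)).
    { apply Rmult_le_compat; try apply Cmod_ge_0; try lra. }
    lra.
Qed.

(** * Real waves and the Hamiltonian *)

Lemma phase_real (d : nat) (k : nat -> Z) (th : vecR) :
  phase d k (toC th) = RtoC (dotZ d th k).
Proof.
  unfold phase, dotZ. induction d as [|d IH]; simpl; [reflexivity|].
  rewrite IH. unfold toC. rewrite RtoC_plus, RtoC_mult. reflexivity.
Qed.

Lemma mode_real (d : nat) (k : nat -> Z) (th : vecR) :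
  mode d k (toC th) = (cos (2 * PI * dotZ d th k), sin (2 * PI * dotZ d th k)).
Proof.
  unfold mode, cexp. rewrite phase_real. unfold Cmult, RtoC; simpl.
  replace (0 * dotZ d th k - 2 * PI * 0) with 0 by ring. rewrite exp_0, !Rmult_1_l.
  f_equal; f_equal; ring.
Qed.

Definition rwave (d : nat) (c : nat -> C) (m : nat -> nat) (k : nat -> nat -> Z)
    (th r : vecR) : R := fst (wave d c m k (toC th) (toC r)).

Definition rterm (d : nat) (c : nat -> C) (m : nat -> nat) (k : nat -> nat -> Z)
    (th r : vecR) (j : nat) : R :=
  r (pred d) ^ m j * (fst (c j) * cos (2 * PI * dotZ d th (k j))
                      - snd (c j) * sin (2 * PI * dotZ d th (k j))).

Lemma rwave_series (d : nat) (c : nat -> C) (m : nat -> nat) (k : nat -> nat -> Z)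
    (th r : vecR) : rwave d c m k th r = Series (rterm d c m k th r).
Proof.
  unfold rwave, wave, cseries. cbn [fst]. apply Series_ext. intros j.
  rewrite mode_real. unfold toC. rewrite <- RtoC_pow. unfold rterm, Cmult, RtoC; simpl. ring.
Qed.

Lemma cexp_2pi_Z (n : Z) : cexp (Cmult (0, 2 * PI) (RtoC (IZR n))) = RtoC 1.
Proof.
  unfold cexp, Cmult, RtoC; simpl.
  replace (0 * IZR n - 2 * PI * 0) with 0 by ring. rewrite exp_0.
  replace (0 * 0 + 2 * PI * IZR n) with (2 * (IZR n * PI)) by ring.
  rewrite cos_2a_sin, sin_2a, (sin_eq_0_1 (IZR n * PI)) by (exists n; reflexivity).
  f_equal; ring.
Qed.

Lemma mode_periodic (d : nat) (k : nat -> Z) (z : vecC) (i : nat) : (i < d)%nat ->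
  mode d k (upd z i (Cplus (z i) (RtoC 1))) = mode d k z.
Proof.
  intros Hi. rewrite (mode_shift d k z _ (RtoC (IZR (k i)))).
  - rewrite cexp_2pi_Z. ring.
  - unfold phase. rewrite csum_upd by exact Hi. ring.
Qed.

(* Equals the real part of the wave on real arguments, and is holomorphic, unlike the real part. *)
Definition cext (d : nat) (c : nat -> C) (m : nat -> nat) (k : nat -> nat -> Z) (z w : vecC) : C :=
  Cplus (Cmult (RtoC (/ 2)) (wave d c m k z w))
        (Cmult (RtoC (/ 2)) (wave d (fun j => Cconj (c j)) m (fun j i => (- k j i)%Z) z w)).

Lemma dotZ_opp (d : nat) (th : vecR) (k : nat -> Z) :
  dotZ d th (fun i => (- k i)%Z) = - dotZ d th k.
Proof.
  unfold dotZ. induction d as [|d IH]; simpl; [ring|]. rewrite IH, opp_IZR. ring.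
Qed.

(** On real arguments, conjugating the coefficients and negating the frequencies conjugates the
    wave, so the half-sum is the real part. *)
Lemma cext_real (d : nat) (c : nat -> C) (m : nat -> nat) (k : nat -> nat -> Z) (th r : vecR) :
  cext d c m k (toC th) (toC r) = RtoC (rwave d c m k th r).
Proof.
  assert (E : wave d (fun j => Cconj (c j)) m (fun j i => (- k j i)%Z) (toC th) (toC r)
     = Cconj (wave d c m k (toC th) (toC r))).
  { unfold wave, cseries, Cconj; cbn [fst snd]. rewrite <- Series_opp. f_equal; apply Series_ext; intros j;
    rewrite !mode_real, dotZ_opp, Ropp_mult_distr_r_reverse, cos_neg, sin_neg;
    unfold toC; rewrite <- RtoC_pow; unfold Cmult, RtoC; simpl; ring. }
  unfold cext. rewrite E. unfold rwave, Cconj, Cplus, Cmult, RtoC; simpl. f_equal; field.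
Qed.

Lemma fast_decay_conj (d : nat) (c : nat -> C) (m : nat -> nat) (k : nat -> nat -> Z)
    (K : nat -> R) : fast_decay d c m k K ->
  fast_decay d (fun j => Cconj (c j)) m (fun j i => (- k j i)%Z) K.
Proof.
  intros (HK & Hk & HS). split; [exact HK|split].
  - intros j i Hi. rewrite opp_IZR, Rabs_Ropp. auto.
  - intros B L HB HL. apply ex_series_ext with (2 := HS B L HB HL).
    intros j. rewrite Cmod_conj. reflexivity.
Qed.

Lemma upd_same {T : Type} (x : nat -> T) (i : nat) (t : T) : upd x i t i = t.
Proof. unfold upd. destruct (Nat.eq_dec i i); [reflexivity|lia]. Qed.

Lemma upd_other {T : Type} (x : nat -> T) (i l : nat) (t : T) : l <> i -> upd x i t l = x l.
Proof. unfold upd. destruct (Nat.eq_dec l i); [lia|reflexivity]. Qed.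

Lemma holomorphic2_wave (d : nat) (c : nat -> C) (m : nat -> nat) (k : nat -> nat -> Z)
    (K : nat -> R) : (0 < d)%nat -> fast_decay d c m k K ->
  holomorphic2 d (fun _ _ => True) (wave d c m k).
Proof.
  intros Hd HF. split; [|split].
  - intros z w _ eps He. destruct (wave_continuous d c m k K z w eps Hd HF He) as [delta [H1 H2]].
    exists delta. split; auto.
  - intros z w i Hi _. eexists. apply (wave_deriv_angle d c m k K z w i Hi HF).
  - intros z w i Hi _. destruct (Nat.eq_dec i (pred d)) as [->|Hn].
    + eexists. apply (wave_deriv_action d c m k K z w HF).
    + exists zero. apply is_derive_ext with (f := fun _ => wave d c m k z w).
      * intros t. apply wave_agree. intros l _; reflexivity. rewrite upd_other; auto.
      * apply (@is_derive_const C_AbsRing C_NormedModule).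
Qed.

Lemma cderiv_ex_lin (a b x : C) (f g : C -> C) : cderiv_ex f x -> cderiv_ex g x ->
  cderiv_ex (fun t => Cplus (Cmult a (f t)) (Cmult b (g t))) x.
Proof.
  intros [f' Hf] [g' Hg]. exists (Cplus (Cmult a f') (Cmult b g')).
  refine (@is_derive_plus C_AbsRing C_NormedModule (fun t => Cmult a (f t)) (fun t => Cmult b (g t)) x _ _ _ _).
  - refine (filterdiff_ext_lin _ _ _ (filterdiff_scal_r_fct (K := C_AbsRing) (U := AbsRing_NormedModule C_AbsRing) (V := C_NormedModule) a f (fun y => scal y f') Cmult_comm Hf) _).
    intros y. change (Cmult a (Cmult y f') = Cmult y (Cmult a f')). change C in y, f'. ring.
  - refine (filterdiff_ext_lin _ _ _ (filterdiff_scal_r_fct (K := C_AbsRing) (U := AbsRing_NormedModule C_AbsRing) (V := C_NormedModule) b g (fun y => scal y g') Cmult_comm Hg) _).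
    intros y. change (Cmult b (Cmult y g') = Cmult y (Cmult b g')). change C in y, g'. ring.
Qed.

Lemma holomorphic2_lin (d : nat) (U : vecC -> vecC -> Prop) (a b : C) (F G : vecC -> vecC -> C) :
  holomorphic2 d U F -> holomorphic2 d U G ->
  holomorphic2 d U (fun z w => Cplus (Cmult a (F z w)) (Cmult b (G z w))).
Proof.
  intros (F1 & F2 & F3) (G1 & G2 & G3). split; [|split].
  - intros z w Hzw eps He. set (e := eps / (Cmod a + Cmod b + 1)).
    generalize (Cmod_ge_0 a) (Cmod_ge_0 b); intros Ha Hb.
    assert (0 < e) by (apply Rdiv_lt_0_compat; lra).
    destruct (F1 z w Hzw e H) as [d1 [Hd1 H1]]. destruct (G1 z w Hzw e H) as [d2 [Hd2 H2]].
    exists (Rmin d1 d2). split; [apply Rmin_pos; lra|]. intros z' w' Hu Hz Hw.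
    assert (A1 : Cmod (Cminus (F z' w') (F z w)) < e).
    { apply H1; auto; intros i Hi; (eapply Rlt_le_trans; [|apply Rmin_l]); eauto. }
    assert (A2 : Cmod (Cminus (G z' w') (G z w)) < e).
    { apply H2; auto; intros i Hi; (eapply Rlt_le_trans; [|apply Rmin_r]); eauto. }
    replace (Cminus _ _) with (Cplus (Cmult a (Cminus (F z' w') (F z w))) (Cmult b (Cminus (G z' w') (G z w)))) by ring.
    eapply Rle_lt_trans; [apply Cmod_triangle|]. rewrite !Cmod_mult.
    assert (eps = e * (Cmod a + Cmod b + 1)) by (unfold e; field; lra).
    assert (Cmod a * Cmod (Cminus (F z' w') (F z w)) <= Cmod a * e) by (apply Rmult_le_compat_l; lra).
    assert (Cmod b * Cmod (Cminus (G z' w') (G z w)) <= Cmod b * e) by (apply Rmult_le_compat_l; lra).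
    lra.
  - intros z w i Hi Hzw. apply (cderiv_ex_lin a b (z i) (fun t => F (upd z i t) w) (fun t => G (upd z i t) w)); auto.
  - intros z w i Hi Hzw. apply (cderiv_ex_lin a b (w i) (fun t => F z (upd w i t)) (fun t => G z (upd w i t))); auto.
Qed.

Lemma holomorphic2_linear_form (d : nat) (a : nat -> C) :
  holomorphic2 d (fun _ _ => True) (fun _ w => csum d (fun i => Cmult (w i) (a i))).
Proof.
  split; [|split].
  - intros z w _ eps He. destruct (bounded_vec d a) as [A [HA0 HA]].
    generalize (pos_INR d); intro Hd.
    assert (Hp : 0 < INR d * A + 1) by nra.
    exists (eps / (INR d * A + 1)). split; [apply Rdiv_lt_0_compat; lra|].
    intros z' w' _ _ Hw. set (e := eps / (INR d * A + 1)) in *.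
    assert (0 < e) by (apply Rdiv_lt_0_compat; lra).
    assert (eps = e * (INR d * A + 1)) by (unfold e; field; lra).
    replace (Cminus _ _) with (csum d (fun i => Cmult (Cminus (w' i) (w i)) (a i))).
    + apply Rle_lt_trans with (INR d * (e * A)); [|nra]. apply csum_le. intros i Hi.
      rewrite Cmod_mult. apply Rmult_le_compat; auto using Cmod_ge_0. apply Rlt_le, Hw, Hi.
    + clear. induction d as [|d IH]; simpl; [ring|]. rewrite IH. ring.
  - intros z w i Hi _. exists zero. apply (@is_derive_const C_AbsRing C_NormedModule).
  - intros z w i Hi _. 
    exists (plus zero (Cmult (RtoC 1) (a i))).
    apply is_derive_ext with
      (f := fun t => Cplus (csum d (fun l => Cmult (w l) (a l))) (Cmult (Cminus t (w i)) (a i))).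
    { intros t. symmetry. apply csum_upd, Hi. }
    refine (@is_derive_plus C_AbsRing C_NormedModule (fun _ => _) (fun t => Cmult (Cminus t (w i)) (a i)) _ _ _ _ _).
    + apply (@is_derive_const C_AbsRing C_NormedModule).
    + split. apply is_linear_scal_l. intros x Hx eps. exists (mkposreal 1 Rlt_0_1). intros y _.
      rewrite <- (is_filter_lim_locally_unique _ _ Hx).
      change (Cmod (Cminus (Cminus (Cmult (Cminus y (w i)) (a i)) (Cmult (Cminus (w i) (w i)) (a i)))
         (Cmult (Cminus y (w i)) (Cmult 1 (a i)))) <= eps * Cmod (Cminus y (w i))).
      change C in y.
      replace (Cminus _ _) with (RtoC 0) by ring. rewrite Cmod_0.
      apply Rmult_le_pos. apply Rlt_le, cond_pos. apply Cmod_ge_0.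
Qed.

Lemma wave_periodic (d : nat) (c : nat -> C) (m : nat -> nat) (k : nat -> nat -> Z) (z w : vecC) (i : nat) :
  (i < d)%nat -> wave d c m k (upd z i (Cplus (z i) (RtoC 1))) w = wave d c m k z w.
Proof.
  intros Hi. unfold wave, cseries. f_equal; apply Series_ext; intros j; rewrite mode_periodic; auto.
Qed.

Lemma cext_periodic (d : nat) (c : nat -> C) (m : nat -> nat) (k : nat -> nat -> Z) (z w : vecC) (i : nat) :
  (i < d)%nat -> cext d c m k (upd z i (Cplus (z i) (RtoC 1))) w = cext d c m k z w.
Proof. intros Hi. unfold cext. rewrite !wave_periodic by exact Hi. reflexivity. Qed.

Lemma cext_agree (d : nat) (c : nat -> C) (m : nat -> nat) (k : nat -> nat -> Z) (z z' w w' : vecC) :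
  agree d z z' -> w (pred d) = w' (pred d) -> cext d c m k z w = cext d c m k z' w'.
Proof.
  intros Hz Hw. unfold cext.
  rewrite (wave_agree d c m k z z' w w' Hz Hw), (wave_agree d _ m _ z z' w w' Hz Hw). reflexivity.
Qed.

Lemma holomorphic2_cext (d : nat) (c : nat -> C) (m : nat -> nat) (k : nat -> nat -> Z) (K : nat -> R) :
  (0 < d)%nat -> fast_decay d c m k K -> holomorphic2 d (fun _ _ => True) (cext d c m k).
Proof.
  intros Hd HF. apply holomorphic2_lin; eapply holomorphic2_wave; eauto using fast_decay_conj.
Qed.

Definition ham (d : nat) (om : vecR) (c : nat -> C) (m : nat -> nat) (k : nat -> nat -> Z)
    (th r : vecR) : R := dot d om r + rwave d c m k th r.

Lemma real_entire_ham (d : nat) (om : vecR) (c : nat -> C) (m : nat -> nat) (k : nat -> nat -> Z)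
    (K : nat -> R) : (0 < d)%nat -> fast_decay d c m k K -> real_entire d (ham d om c m k).
Proof.
  intros Hd HF.
  exists (fun z w => Cplus (Cmult (RtoC 1) (csum d (fun i => Cmult (w i) (RtoC (om i)))))
                           (Cmult (RtoC 1) (cext d c m k z w))).
  split; [|split; [|split]].
  - intros z z' w w' Hz Hw. rewrite (cext_agree d c m k z z' w w' Hz) by (apply Hw; lia).
    do 2 f_equal. apply csum_ext. intros i Hi. rewrite Hw; auto.
  - intros z w i Hi. rewrite cext_periodic; auto.
  - apply holomorphic2_lin. apply holomorphic2_linear_form. eapply holomorphic2_cext; eauto.
  - intros th r. rewrite cext_real. unfold ham. rewrite RtoC_plus, !Cmult_1_l. f_equal.
    unfold dot. clear. induction d as [|d IH]; simpl; [reflexivity|].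
    rewrite IH. unfold toC. rewrite RtoC_plus, RtoC_mult. ring.
Qed.

Lemma real_analytic_rwave (d : nat) (c : nat -> C) (m : nat -> nat) (k : nat -> nat -> Z)
    (K : nat -> R) (r : vecR) : (0 < d)%nat -> fast_decay d c m k K ->
  real_analytic_T d (fun th => rwave d c m k th r).
Proof.
  intros Hd HF. exists 1. split; [lra|]. exists (fun z => cext d c m k z (toC r)).
  split; [|split; [|split]].
  - intros z z' Hz. apply cext_agree; auto.
  - intros z i Hi. apply cext_periodic; auto.
  - destruct (holomorphic2_cext d c m k K Hd HF) as (H1 & H2 & _). split.
    + intros z _ eps He. destruct (H1 z (toC r) I eps He) as [delta [Hp H]].
      exists delta. split; [exact Hp|]. intros z' _ Hz. apply H; auto.
      intros i _. replace (Cminus _ _) with (RtoC 0) by ring. rewrite Cmod_0. exact Hp.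
    + intros z i Hi _. apply H2; auto.
  - intros th. apply cext_real.
Qed.

Lemma real_analytic_trig (d : nat) (k : nat -> Z) (a b : R) : (0 < d)%nat ->
  real_analytic_T d (fun th => a * cos (2 * PI * dotZ d th k) + b * sin (2 * PI * dotZ d th k)).
Proof.
  intros Hd.
  assert (HK : exists K, 0 <= K /\ forall i, (i < d)%nat -> Rabs (IZR (k i)) <= K).
  { destruct (bounded_vec d (fun i => RtoC (IZR (k i)))) as [K [H0 H]]. exists K. split; auto.
    intros i Hi. rewrite <- Cmod_R. auto. }
  destruct HK as [K [HK0 HK]].
  (* The weights (1/2)^(j+1) add up to 1, so this wave is the single mode. *)
  set (c := fun j => Cmult (RtoC ((1 / 2) ^ j)) (a / 2, - b / 2)).
  destruct (real_analytic_rwave d c (fun _ => O) (fun _ => k) (fun _ => K) (fun _ => 0) Hd)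
    as [s [Hs [A (H1 & H2 & H3 & H4)]]].
  { split; [auto|split; [auto|]]. intros B L HB HL.
    apply ex_series_ext with (fun j => (1 / 2) ^ j * (Cmod (a / 2, - b / 2) * B ^ 0 * exp (L * K))).
    - intros j. unfold c. rewrite Cmod_mult, Cmod_R, Rabs_right. match goal with |- @eq _ ?x ?y => change (@eq R x y) end. ring.
      apply Rle_ge, pow_le; lra.
    - apply ex_series_scal_r. apply ex_series_geom. rewrite Rabs_right; lra. }
  exists s. split; [exact Hs|]. exists A. split; [exact H1|split; [exact H2|split; [exact H3|]]].
  intros th. rewrite H4, rwave_series. f_equal.
  rewrite (Series_ext _ (fun j => (1 / 2) ^ j * (a / 2 * cos (2 * PI * dotZ d th k) + b / 2 * sin (2 * PI * dotZ d th k)))).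
  - rewrite Series_scal_r, Series_geom by (rewrite Rabs_right; lra). field.
  - intros j. unfold rterm, c; simpl. field.
Qed.

(** The complex difference quotient is restricted to real increments and |Re| <= |.| is applied.
    This transfers the termwise complex derivatives to the real partial derivatives of the
    Hamiltonian. *)
Lemma is_derive_real_part (f : C -> C) (x : R) (D : C) :
  @is_derive C_AbsRing C_NormedModule f (RtoC x) D ->
  is_derive (fun t => fst (f (RtoC t))) x (fst D).
Proof.
  intros [_ H]. split; [apply is_linear_scal_l|].
  intros x0 Hx0 eps. rewrite <- (is_filter_lim_locally_unique _ _ Hx0). clear x0 Hx0.
  destruct (H (RtoC x) (fun P HP => HP) eps) as [delta Hdel].
  exists delta. intros t Ht. change (Rabs (t - x) < delta) in Ht.
  assert (E : Cmod (Cminus (RtoC t) (RtoC x)) = Rabs (t - x)) by (rewrite <- RtoC_minus; apply Cmod_R).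
  generalize (Hdel (RtoC t)). intros G.
  assert (Hb : @ball (AbsRing_UniformSpace C_AbsRing) (RtoC x) delta (RtoC t)).
  { change (Cmod (Cminus (RtoC t) (RtoC x)) < delta). rewrite E. exact Ht. }
  specialize (G Hb).
  change (Cmod (Cminus (Cminus (f (RtoC t)) (f (RtoC x))) (Cmult (Cminus (RtoC t) (RtoC x)) D))
     <= eps * Cmod (Cminus (RtoC t) (RtoC x))) in G. rewrite E in G.
  change (Rabs (fst (f (RtoC t)) - fst (f (RtoC x)) - (t - x) * fst D) <= eps * Rabs (t - x)).
  eapply Rle_trans; [|exact G]. eapply Rle_trans; [|apply re_le_Cmod].
  apply Req_le. f_equal. unfold Cminus, Cplus, Copp, Cmult, RtoC, Re; simpl. ring.
Qed.

Lemma toC_upd (d : nat) (x : vecR) (i : nat) (t : R) : agree d (upd (toC x) i (RtoC t)) (toC (upd x i t)).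
Proof. intros l _. unfold toC, upd. destruct (Nat.eq_dec l i); reflexivity. Qed.

Lemma rwave_deriv_angle (d : nat) (c : nat -> C) (m : nat -> nat) (k : nat -> nat -> Z)
    (K : nat -> R) (th r : vecR) (i : nat) : (i < d)%nat -> fast_decay d c m k K ->
  is_derive (fun t => rwave d c m k (upd th i t) r) (th i)
    (rwave d (fun j => Cmult (Cmult (0, 2 * PI) (IZR (k j i))) (c j)) m k th r).
Proof.
  intros Hi HF.
  apply is_derive_ext with (f := fun t => fst (wave d c m k (upd (toC th) i (RtoC t)) (toC r))).
  - intros t. unfold rwave. f_equal. apply wave_agree; [apply toC_upd|reflexivity].
  - apply (is_derive_real_part (fun t => wave d c m k (upd (toC th) i t) (toC r))).
    apply (wave_deriv_angle d c m k K (toC th) (toC r) i Hi HF).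
Qed.

Lemma rwave_deriv_action (d : nat) (c : nat -> C) (m : nat -> nat) (k : nat -> nat -> Z)
    (K : nat -> R) (th r : vecR) : fast_decay d c m k K ->
  is_derive (fun t => rwave d c m k th (upd r (pred d) t)) (r (pred d))
    (rwave d (fun j => Cmult (INR (m j)) (c j)) (fun j => pred (m j)) k th r).
Proof.
  intros HF.
  apply is_derive_ext with (f := fun t => fst (wave d c m k (toC th) (upd (toC r) (pred d) (RtoC t)))).
  - intros t. unfold rwave. f_equal. apply wave_agree; [intros l _; reflexivity|].
    apply (toC_upd (S (pred d))). lia.
  - apply (is_derive_real_part (fun t => wave d c m k (toC th) (upd (toC r) (pred d) t))).
    apply (wave_deriv_action d c m k K (toC th) (toC r) HF).
Qed.

(** * Orbits *)

Lemma rsum_ext (n : nat) (f g : nat -> R) :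
  (forall i, (i < n)%nat -> f i = g i) -> rsum n f = rsum n g.
Proof.
  induction n as [|n IH]; simpl; intros H; [reflexivity|].
  rewrite IH, H by (intros; try apply H; lia). reflexivity.
Qed.

Lemma rsum_lin (n : nat) (a b : R) (f g : nat -> R) :
  rsum n (fun i => a * f i + b * g i) = a * rsum n f + b * rsum n g.
Proof. induction n as [|n IH]; simpl; [ring|rewrite IH; ring]. Qed.

Lemma rsum_single (n i : nat) (f : nat -> R) : (i < n)%nat ->
  (forall l, (l < n)%nat -> l <> i -> f l = 0) -> rsum n f = f i.
Proof.
  induction n as [|n IH]; intros Hi H; [lia|]. simpl.
  destruct (Nat.eq_dec i n) as [->|Hn].
  - assert (E : rsum n f = 0); [|lra].
    rewrite (rsum_ext n f (fun l => 0 * 0 + 0 * 0)).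
    + rewrite (rsum_lin n 0 0 (fun _ => 0) (fun _ => 0)). ring.
    + intros l Hl. rewrite H by lia. ring.
  - rewrite IH, (H n) by (intros; try apply H; lia). ring.
Qed.

Lemma rsum_nonneg (n : nat) (f : nat -> R) : (forall i, (i < n)%nat -> 0 <= f i) -> 0 <= rsum n f.
Proof.
  induction n as [|n IH]; simpl; intros H; [lra|].
  assert (0 <= rsum n f) by (apply IH; intros; apply H; lia). generalize (H n ltac:(lia)). lra.
Qed.

Lemma rsum_ge_term (n i : nat) (f : nat -> R) : (i < n)%nat ->
  (forall i, (i < n)%nat -> 0 <= f i) -> f i <= rsum n f.
Proof.
  induction n as [|n IH]; intros Hi H; [lia|]. simpl.
  generalize (H n ltac:(lia)). intro.
  destruct (Nat.eq_dec i n) as [->|Hn].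
  - generalize (rsum_nonneg n f (fun l Hl => H l ltac:(lia))). lra.
  - assert (f i <= rsum n f) by (apply IH; [lia|intros; apply H; lia]). lra.
Qed.

Lemma coord_le_normd (d i : nat) (r : vecR) : (i < d)%nat -> Rabs (r i) <= normd d r.
Proof.
  intros Hi. unfold normd. rewrite <- sqrt_Rsqr_abs. apply sqrt_le_1_alt.
  replace (Rsqr (r i)) with (r i ^ 2) by (unfold Rsqr; ring).
  apply (rsum_ge_term d i (fun i => r i ^ 2) Hi). intros; apply pow2_ge_0.
Qed.

Lemma normd_axis (d i : nat) (r : vecR) : (i < d)%nat ->
  (forall l, (l < d)%nat -> l <> i -> r l = 0) -> normd d r = Rabs (r i).
Proof.
  intros Hi H. unfold normd. rewrite (rsum_single d i) by (auto; intros; rewrite H; auto; ring).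
  rewrite <- sqrt_Rsqr_abs. f_equal. unfold Rsqr. ring.
Qed.

Lemma Series_abs_le (a b : nat -> R) :
  (forall j, Rabs (a j) <= b j) -> ex_series b -> Rabs (Series a) <= Series b.
Proof.
  intros H Hb.
  apply (is_series_norm_le (K := R_AbsRing) (V := R_NormedModule) a b).
  - apply Series_correct. eapply ex_series_dominated; eauto.
  - apply Series_correct. exact Hb.
  - exact H.
Qed.

Lemma fast_decay_at (d : nat) (c : nat -> C) (m : nat -> nat) (k : nat -> nat -> Z)
    (K : nat -> R) (s L : R) : fast_decay d c m k K -> 0 <= L ->
  ex_series (fun j => Cmod (c j) * Rabs s ^ m j * exp (L * K j)).
Proof.
  intros (HK & Hk & HS) HL.
  apply ex_series_dominated with (2 := HS (Rabs s + 1) L ltac:(generalize (Rabs_pos s); lra) HL).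
  intros j. generalize (Rabs_pos s) (Cmod_ge_0 (c j)) (exp_pos (L * K j)); intros.
  assert (0 <= Rabs s ^ m j) by (apply pow_le; lra).
  assert (Rabs s ^ m j <= (Rabs s + 1) ^ m j) by (apply pow_incr; lra).
  rewrite Rabs_right by (apply Rle_ge; repeat apply Rmult_le_pos; lra).
  apply Rmult_le_compat_r; [lra|]. apply Rmult_le_compat_l; lra.
Qed.

Lemma dotZ_le (d : nat) (w : vecR) : exists W, 0 <= W /\
  forall (k : nat -> Z) (K : R), (forall i, (i < d)%nat -> Rabs (IZR (k i)) <= K) ->
    Rabs (dotZ d w k) <= W * K.
Proof.
  destruct (bounded_vec d (toC w)) as [Z0 [H0 H]]. exists (INR d * Z0).
  split. apply Rmult_le_pos; [apply pos_INR|exact H0].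
  intros k K HK. rewrite <- Cmod_R, <- phase_real, Rmult_assoc. apply phase_le; auto.
Qed.

(* The integral of [sin (al + be * u)] for u from 0 to t. *)
Definition sin_prim (al be t : R) : R := (cos al - cos (al + be * t)) / be.

Lemma sin_prim_le (al be t : R) : be <> 0 -> Rabs (sin_prim al be t) <= Rabs t.
Proof.
  intros Hb. unfold sin_prim, Rdiv. rewrite Rabs_mult, Rabs_inv.
  assert (0 < Rabs be) by (apply Rabs_pos_lt, Hb).
  apply Rmult_le_reg_r with (Rabs be); [assumption|].
  rewrite Rmult_assoc, Rinv_l, Rmult_1_r by lra.
  eapply Rle_trans; [apply cos_lip|]. replace (al - (al + be * t)) with (- (t * be)) by ring.
  rewrite Rabs_Ropp, Rabs_mult. lra.
Qed.

(** This is the averaging bound: uniform in time, at the price of a small divisor. It serves the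
    modes that have oscillated, while [sin_prim_le] serves those still frozen. *)
Lemma sin_prim_le_inv (al be t : R) : be <> 0 -> Rabs (sin_prim al be t) <= 2 / Rabs be.
Proof.
  intros Hb. unfold sin_prim, Rdiv. rewrite Rabs_mult, Rabs_inv.
  apply Rmult_le_compat_r. apply Rlt_le, Rinv_0_lt_compat, Rabs_pos_lt, Hb.
  generalize (COS_bound al) (COS_bound (al + be * t)); intros. apply Rabs_le; lra.
Qed.

Lemma sin_prim_quad (al be x t : R) : be <> 0 ->
  Rabs (sin_prim al be t - sin_prim al be x - (t - x) * sin (al + be * x))
    <= 2 * Rabs be * Rabs (t - x) ^ 2.
Proof.
  intros Hb. unfold sin_prim.
  replace (_ - _ - _) with
    (- (cos ((al + be * x) + be * (t - x)) - cos (al + be * x) - (be * (t - x)) * - sin (al + be * x)) / be).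
  2:{ replace (al + be * x + be * (t - x)) with (al + be * t) by ring. field. exact Hb. }
  unfold Rdiv. rewrite Rabs_mult, Rabs_Ropp, Rabs_inv.
  assert (0 < Rabs be) by (apply Rabs_pos_lt, Hb).
  apply Rmult_le_reg_r with (Rabs be); [assumption|].
  rewrite Rmult_assoc, Rinv_l, Rmult_1_r by lra.
  eapply Rle_trans; [apply cos_quad|]. rewrite Rpow_mult_distr, <- (pow2_abs be), <- (pow2_abs (t - x)).
  apply Req_le. ring.
Qed.

Lemma is_derive_sin_prim_series (A al be : nat -> R) (x : R) :
  (forall j, be j <> 0) -> ex_series (fun j => Rabs (A j)) ->
  ex_series (fun j => Rabs (A j) * Rabs (be j)) ->
  is_derive (fun t => Series (fun j => A j * sin_prim (al j) (be j) t)) x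
    (Series (fun j => A j * sin (al j + be j * x))).
Proof.
  intros Hb HA HAb.
  apply (is_derive_series (K := R_AbsRing) (V := R_NormedModule)
    (fun j t => A j * sin_prim (al j) (be j) t) (fun j => A j * sin (al j + be j * x)) _ _
    (fun j => 2 * (Rabs (A j) * Rabs (be j)))).
  - intros t. apply Series_correct.
    apply ex_series_dominated with (fun j => Rabs (A j) * Rabs t).
    + intros j. rewrite Rabs_mult. apply Rmult_le_compat_l; [apply Rabs_pos|].
      apply sin_prim_le, Hb.
    + apply ex_series_scal_r, HA.
  - apply Series_correct. apply ex_series_dominated with (2 := HA).
    intros j. rewrite Rabs_mult. rewrite <- Rmult_1_r.
    apply Rmult_le_compat_l; [apply Rabs_pos|]. apply Rabs_le, SIN_bound.
  - refine (ex_series_scal_l _ _ _). exact HAb.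
  - intros j t _.
    change (Rabs (A j * sin_prim (al j) (be j) t - A j * sin_prim (al j) (be j) x
       - (t - x) * (A j * sin (al j + be j * x))) <= 2 * (Rabs (A j) * Rabs (be j)) * Rabs (t - x) ^ 2).
    replace (_ - _ - _) with (A j * (sin_prim (al j) (be j) t - sin_prim (al j) (be j) x
       - (t - x) * sin (al j + be j * x))) by ring.
    rewrite Rabs_mult. generalize (sin_prim_quad (al j) (be j) x t (Hb j)) (Rabs_pos (A j)). intros.
    apply Rle_trans with (Rabs (A j) * (2 * Rabs (be j) * Rabs (t - x) ^ 2)); [|lra].
    apply Rmult_le_compat_l; lra.
Qed.

Lemma dot_upd (d : nat) (w r : vecR) (i : nat) (t : R) : (i < d)%nat ->
  dot d w (upd r i t) = dot d w r + w i * (t - r i).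
Proof.
  unfold dot. induction d as [|d IH]; intros Hi; [lia|]. simpl.
  destruct (Nat.eq_dec i d) as [->|Hn].
  - rewrite upd_same, (rsum_ext d _ (fun l => w l * r l)). ring.
    intros l Hl. rewrite upd_other by lia. reflexivity.
  - rewrite IH, upd_other by lia. ring.
Qed.

Lemma rwave_agree (d : nat) (c : nat -> C) (m : nat -> nat) (k : nat -> nat -> Z) (th th' r r' : vecR) :
  agree d th th' -> r (pred d) = r' (pred d) -> rwave d c m k th r = rwave d c m k th' r'.
Proof.
  intros Hth Hr. unfold rwave. f_equal. apply wave_agree.
  - intros i Hi. unfold toC. rewrite Hth; auto.
  - unfold toC. rewrite Hr. reflexivity.
Qed.

Section Dynamics.
Variables (d : nat) (om : vecR) (rho : nat -> R) (m : nat -> nat) (k : nat -> nat -> Z) (K : nat -> R).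
Hypothesis Hd : (2 <= d)%nat.
Let c : nat -> C := fun j => RtoC (rho j).
Hypothesis HF : fast_decay d c m k K.
Hypothesis Hkd : forall j, k j (pred d) = 0%Z.
Let lam (j : nat) : R := dotZ d om (k j).
Hypothesis Hlam : forall j, lam j <> 0.

Let H := ham d om c m k.

Lemma dt_ham (i : nat) (th r : vecR) : (i < d)%nat ->
  - dt H i th r = Series (fun j => 2 * PI * IZR (k j i) * rho j * r (pred d) ^ m j
                                     * sin (2 * PI * dotZ d th (k j))).
Proof.
  intros Hi. unfold dt.
  rewrite (is_derive_unique _ _ (rwave d (fun j => Cmult (Cmult (0, 2 * PI) (IZR (k j i))) (c j)) m k th r)).
  - rewrite rwave_series, <- Series_opp. apply Series_ext. intros j. unfold rterm, c, Cmult, RtoC; simpl. ring.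
  - unfold H, ham. 
    replace (rwave d _ m k th r) with (0 + rwave d (fun j => Cmult (Cmult (0, 2 * PI) (IZR (k j i))) (c j)) m k th r) by ring.
    refine (is_derive_plus (fun _ => dot d om r) (fun t => rwave d c m k (upd th i t) r) _ _ _ _ _).
    + refine (is_derive_const _ _).
    + apply (rwave_deriv_angle d c m k K th r i Hi HF).
Qed.

Lemma dr_ham_lt (i : nat) (th r : vecR) : (i < pred d)%nat -> dr H i th r = om i.
Proof.
  intros Hi. unfold dr. apply is_derive_unique.
  apply is_derive_ext with (f := fun t => dot d om r + om i * (t - r i) + rwave d c m k th r).
  - intros t. unfold H, ham. rewrite dot_upd by lia. f_equal. apply rwave_agree.
    intros l _; reflexivity. rewrite upd_other; [reflexivity|lia].
  - auto_derive; auto. ring.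
Qed.

Lemma dr_ham_last (th r : vecR) :
  dr H (pred d) th r = om (pred d) +
    Series (fun j => INR (m j) * rho j * r (pred d) ^ pred (m j) * cos (2 * PI * dotZ d th (k j))).
Proof.
  unfold dr. apply is_derive_unique.
  apply is_derive_ext with (f := fun t => (dot d om r + om (pred d) * (t - r (pred d)))
     + rwave d c m k th (upd r (pred d) t)).
  - intros t. unfold H, ham. rewrite dot_upd by lia. reflexivity.
  - refine (is_derive_plus (fun t => dot d om r + om (pred d) * (t - r (pred d))) (fun t => rwave d c m k th (upd r (pred d) t)) _ _ _ _ _).
    + auto_derive; auto. ring.
    + rewrite (Series_ext _ (rterm d (fun j => Cmult (INR (m j)) (c j)) (fun j => pred (m j)) k th r)).
      * rewrite <- rwave_series. apply (rwave_deriv_action d c m k K th r HF).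
      * intros j. unfold rterm, c, Cmult, RtoC; simpl. ring.
Qed.

Section Orbit.
Variables (th0 : vecR) (s : R).
Let al (j : nat) : R := 2 * PI * dotZ d th0 (k j).
Let be (j : nat) : R := 2 * PI * lam j.

(** The phase shift π/2 turns the primitive of a sine into that of a cosine, as the last angle
    requires. That angle starts at 0 instead of [th0], which is harmless because no frequency
    involves it. *)
Definition orbit_th (t : R) : vecR := fun i =>
  if Nat.eq_dec i (pred d)
  then om i * t + Series (fun j => INR (m j) * rho j * s ^ pred (m j) * sin_prim (al j + PI / 2) (be j) t)
  else th0 i + om i * t.

(** [sin_prim] vanishes at time 0, so all actions but the last start at 0 and the initial distance
    to the torus is |s|. *)
Definition orbit_r (t : R) : vecR := fun i =>
  if Nat.eq_dec i (pred d) then s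
  else Series (fun j => 2 * PI * IZR (k j i) * rho j * s ^ m j * sin_prim (al j) (be j) t).

Lemma be_neq0 (j : nat) : be j <> 0.
Proof.
  unfold be. generalize PI_RGT_0 (Hlam j); intros HP Hl E.
  apply Rmult_integral in E. destruct E; [lra|auto].
Qed.

(** The second sum, weighted by the angular speeds, controls the quadratic remainders when the
    series of primitives is differentiated. The speeds grow at most linearly in [K j], so one
    exponential weight covers them. *)
Lemma orbit_coef_summable (c' : nat -> C) (m' : nat -> nat) (A : nat -> R) :
  fast_decay d c' m' k K -> (forall j, Rabs (A j) <= Cmod (c' j) * Rabs s ^ m' j) ->
  ex_series (fun j => Rabs (A j)) /\ ex_series (fun j => Rabs (A j) * Rabs (be j)).
Proof.
  intros HF' HA. split.
  - apply ex_series_dominated with (2 := fast_decay_at d c' m' k K s 0 HF' (Rle_refl 0)).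
    intros j. rewrite Rabs_Rabsolu, Rmult_0_l, exp_0, Rmult_1_r. apply HA.
  - destruct (dotZ_le d om) as [W [HW0 HW]].
    apply ex_series_dominated with (fun j => 8 * W * (Cmod (c' j) * Rabs s ^ m' j * exp (1 * K j))).
    + intros j. rewrite Rabs_mult, !Rabs_Rabsolu.
      replace (8 * W * _) with ((Cmod (c' j) * Rabs s ^ m' j) * (8 * W * exp (1 * K j))) by ring.
      apply Rmult_le_compat; try apply Rabs_pos; [apply HA|].
      unfold be. rewrite !Rabs_mult, (Rabs_right 2), (Rabs_right PI) by (generalize PI_RGT_0; lra).
      destruct HF' as (HK & Hk & _). generalize (HW (k j) (K j) (Hk j)). fold (lam j).
      rewrite Rmult_1_l. generalize (exp_ge_1_plus (K j)) PI_4 PI_RGT_0 (Rabs_pos (lam j)). intros.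
      assert (2 * PI * Rabs (lam j) <= 8 * Rabs (lam j)) by (apply Rmult_le_compat_r; lra).
      assert (W * K j <= W * exp (K j)) by (apply Rmult_le_compat_l; lra). lra.
    + refine (ex_series_scal_l _ _ _). apply (fast_decay_at d c' m' k K s 1 HF'). lra.
Qed.

(** The last angle, the only one with a complicated motion, is multiplied by [k j (pred d) = 0].
    Every phase is therefore affine in time, and the closed form can solve the equations. *)
Lemma orbit_phase (t : R) (j : nat) :
  2 * PI * dotZ d (orbit_th t) (k j) = al j + be j * t.
Proof.
  unfold al, be, lam. 
  assert (E : dotZ d (orbit_th t) (k j) = 1 * dotZ d th0 (k j) + t * dotZ d om (k j)); [|rewrite E; ring].
  unfold dotZ. rewrite <- rsum_lin. apply rsum_ext. intros i Hi. unfold orbit_th.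
  destruct (Nat.eq_dec i (pred d)) as [->|]; [rewrite Hkd|]; ring.
Qed.

Lemma orbit_derive (t : R) (i : nat) : (i < d)%nat ->
  is_derive (fun u => orbit_th u i) t (dr H i (orbit_th t) (orbit_r t)) /\
  is_derive (fun u => orbit_r u i) t (- dt H i (orbit_th t) (orbit_r t)).
Proof.
  intros Hi.
  assert (Er : orbit_r t (pred d) = s).
  { unfold orbit_r. destruct (Nat.eq_dec (pred d) (pred d)); [reflexivity|lia]. }
  rewrite (dt_ham i _ _ Hi), Er.
  rewrite (Series_ext _ (fun j => 2 * PI * IZR (k j i) * rho j * s ^ m j * sin (al j + be j * t)))
    by (intros j; rewrite orbit_phase; reflexivity).
  unfold orbit_th at 1, orbit_r at 2. destruct (Nat.eq_dec i (pred d)) as [->|Hn].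
  - rewrite dr_ham_last, Er. split.
    + refine (is_derive_plus (fun u => om (pred d) * u) _ _ _ _ _ _).
      * auto_derive; auto; ring.
      * rewrite (Series_ext _ (fun j => INR (m j) * rho j * s ^ pred (m j) * sin (al j + PI / 2 + be j * t))).
        -- destruct (orbit_coef_summable _ _ (fun j => INR (m j) * rho j * s ^ pred (m j))
             (fast_decay_action d c m k K HF)) as [S1 S2].
           { intros j. unfold c. rewrite Cmod_mult, !Cmod_R, !Rabs_mult, RPow_abs. lra. }
           apply (is_derive_sin_prim_series _ (fun j => al j + PI / 2) be t be_neq0 S1 S2).
        -- intros j. rewrite orbit_phase. rewrite cos_sin. do 2 f_equal. ring.
    + rewrite (Series_ext _ (fun _ => 0 * 0)).
      * rewrite Series_scal_l, Rmult_0_l. refine (is_derive_const _ _).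
      * intros j. rewrite Hkd. ring.
  - rewrite dr_ham_lt by lia. split.
    + auto_derive; auto; ring.
    + destruct (orbit_coef_summable _ _ (fun j => 2 * PI * IZR (k j i) * rho j * s ^ m j)
             (fast_decay_angle d c m k K i Hi HF)) as [S1 S2].
      { intros j. unfold c. rewrite !Cmod_mult, !Cmod_R, !Rabs_mult, RPow_abs.
        replace (Cmod (0, 2 * PI)) with (Rabs 2 * Rabs PI); [lra|].
        replace (0, 2 * PI) with (Cmult Ci (RtoC (2 * PI))).
        - rewrite Cmod_mult, Cmod_R, Cmod_Ci, Rabs_mult. ring.
        - unfold Cmult, Ci, RtoC; simpl; f_equal; ring. }
      apply (is_derive_sin_prim_series _ al be t be_neq0 S1 S2).
Qed.

End Orbit.
End Dynamics.

(** * Drift *)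

Lemma is_series_single (n : nat) (v : R) :
  is_series (fun j => if Nat.eq_dec j n then v else 0) v.
Proof.
  unfold is_series.
  assert (E : forall N, sum_n (fun j => if Nat.eq_dec j n then v else 0) N = if le_dec n N then v else 0).
  { induction N as [|N IH].
    - rewrite sum_O. destruct (Nat.eq_dec 0 n), (le_dec n 0); try lia; reflexivity.
    - rewrite sum_Sn, IH. change plus with Rplus.
      destruct (Nat.eq_dec (S N) n), (le_dec n N), (le_dec n (S N)); try lia; simpl; ring. }
  apply filterlim_ext_loc with (fun _ => v).
  - exists n. intros N HN. rewrite E. destruct (le_dec n N); [reflexivity|lia].
  - apply filterlim_const.
Qed.

(** A reverse triangle inequality: [b] is the sequence with its n-th term erased, and [e] dominates
    it without having to bound [a n]. *)
Lemma Series_dominant_term (n : nat) (a e : nat -> R) :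
  (forall j, j <> n -> Rabs (a j) <= e j) -> (forall j, 0 <= e j) -> ex_series e ->
  Rabs (a n) - Series e <= Rabs (Series a).
Proof.
  intros Ha He Hs.
  set (b := fun j => a j - (if Nat.eq_dec j n then a n else 0)).
  assert (Hb : forall j, Rabs (b j) <= e j).
  { intros j. unfold b. destruct (Nat.eq_dec j n) as [->|Hj].
    - rewrite Rminus_diag, Rabs_R0. apply He.
    - rewrite Rminus_0_r. apply Ha, Hj. }
  assert (E : Series a = Series b + a n).
  { rewrite <- (is_series_unique _ _ (is_series_single n (a n))) at 1.
    rewrite <- Series_plus.
    - apply Series_ext. intros j. unfold b. destruct (Nat.eq_dec j n); ring.
    - apply ex_series_dominated with e; assumption.
    - eexists. apply is_series_single. }
  rewrite E. generalize (Series_abs_le b e Hb Hs) (Rabs_triang (Series b + a n) (- Series b)).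
  rewrite Rabs_Ropp. replace (Series b + a n + - Series b) with (a n) by ring. lra.
Qed.

Lemma normd_continuity (d : nat) (x : R -> vecR) :
  (forall t i, (i < d)%nat -> ex_derive (fun u => x u i) t) -> continuity (fun t => normd d (x t)).
Proof.
  intros Hx t. unfold normd.
  apply (continuity_pt_comp (fun t => rsum d (fun i => x t i ^ 2)) sqrt).
  - induction d as [|d IH]; simpl.
    + apply continuity_pt_const. intros u v; reflexivity.
    + apply (continuity_pt_plus (fun t => rsum d (fun i => x t i * (x t i * 1))) (fun t => x t d * (x t d * 1))).
      * apply IH. intros; apply Hx; lia.
      * assert (Hc : continuity_pt (fun t => x t d) t).
        { apply continuity_pt_filterlim, (ex_derive_continuous (fun t => x t d)), Hx. lia. }
        apply (continuity_pt_mult (fun t => x t d) (fun t => x t d * 1)); [exact Hc|].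
        apply (continuity_pt_mult (fun t => x t d) (fun _ => 1)); [exact Hc|].
        apply continuity_pt_const. unfold constant; auto.
  - apply continuity_pt_sqrt. apply rsum_nonneg. intros; apply pow2_ge_0.
Qed.

(** The distance is continuous in time, and r < 1 gives r < 1/r, so the value 1/r is crossed after
    time 0. *)
Lemma hit_of_orbit (d : nat) (H : vecR -> vecR -> R) (Th Rr : R -> vecR) (T r : R) :
  (forall t i, (i < d)%nat ->
    is_derive (fun u => Th u i) t (dr H i (Th t) (Rr t)) /\
    is_derive (fun u => Rr u i) t (- dt H i (Th t) (Rr t))) ->
  0 < r < 1 -> 0 < T -> normd d (Rr 0) <= r -> / r <= normd d (Rr T) ->
  exists t, 0 < t <= T /\ hit_times d H r t.
Proof.
  intros HD Hr HT H0 H1.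
  assert (Hr1 : 1 < / r) by (rewrite <- Rinv_1; apply Rinv_lt_contravar; lra).
  destruct (IVT_gen (fun t => normd d (Rr t)) 0 T (/ r)) as [t [Ht E]].
  - apply normd_continuity. intros t i Hi. eexists. apply (HD t i Hi).
  - rewrite Rmin_left, Rmax_right by lra. lra.
  - rewrite Rmin_left, Rmax_right in Ht by lra. simpl in E.
    assert (t <> 0) by (intros ->; lra).
    exists t. split; [lra|]. split; [lra|].
    exists (Th 0), (Rr 0). split; [exact H0|]. exists Th, Rr.
    repeat split; auto; apply HD; auto.
Qed.

(** [real] would send an infinite bound to 0. The hit [t] excludes plus infinity and positivity of
    the hit times excludes minus infinity, so the infimum is a genuine number. *)
Lemma Tdiff_le (d : nat) (H : vecR -> vecR -> R) (r t : R) : hit_times d H r t -> Tdiff d H r <= t.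
Proof.
  intros Ht. unfold Tdiff.
  destruct (Glb_Rbar_correct (hit_times d H r)) as [H1 H2].
  generalize (H1 t Ht) (H2 (Finite 0)).
  intros A B. assert (Rbar_le 0 (Glb_Rbar (hit_times d H r))).
  { apply B. intros x [Hx _]. simpl. lra. }
  destruct (Glb_Rbar (hit_times d H r)); simpl in *; auto; contradiction.
Qed.

(* [res_small] freezes mode j up to time [/ rho j ^ (m j + 2)]; [res_next] makes the later modes
   negligible and lets the earlier ones average out on the level [r_d = rho j]. *)
Record resonant (d : nat) (om : vecR) (m : nat -> nat) (k : nat -> nat -> Z)
    (K rho : nat -> R) : Prop := {
  res_last : forall j, k j (pred d) = 0%Z;
  res_K : forall j, 1 <= K j;
  res_k : forall j i, Rabs (IZR (k j i)) <= K j;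
  res_max : forall j, exists i, (i < pred d)%nat /\ Rabs (IZR (k j i)) = K j;
  res_lam : forall j, dotZ d om (k j) <> 0;
  res_pos : forall j, 0 < rho j;
  res_rho : forall j, rho j <= exp (- (INR (S j) ^ 2 * K j));
  res_small : forall j, 16 * Rabs (dotZ d om (k j)) <= rho j ^ (m j + 2);
  res_next : forall j, rho (S j) <=
    Rabs (dotZ d om (k j)) * exp (- (INR (S (S j)) ^ 2 * K (S j))) }.

Lemma half_pow_ge (n : nat) : exp (- INR n) <= (1 / 2) ^ n.
Proof.
  induction n as [|n IH]; [simpl; rewrite Ropp_0, exp_0; lra|].
  rewrite S_INR. replace (- (INR n + 1)) with (-1 + - INR n) by ring. rewrite exp_plus. simpl.
  apply Rmult_le_compat; try (apply Rlt_le, exp_pos); auto.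
  replace (-1) with (- (1)) by ring. rewrite exp_Ropp. replace (1 / 2) with (/ 2) by field. apply Rinv_le_contravar; [lra|].
  generalize (exp_ge_1_plus 1); lra.
Qed.

(** Since X <= exp(X - 1), the exponent is at most 1 - ((j+1)^2 - 1) - 1 <= -(j+1) for X >= 1, up to
    the term 1 that is left over. It makes the weights [K j * rho j] of the action equations
    geometric. *)
Lemma weight_le (j : nat) (X : R) : 1 <= X -> X * exp (- (INR (S j) ^ 2 * X)) <= (1 / 2) ^ S j.
Proof.
  intros HX. apply Rle_trans with (2 := half_pow_ge (S j)).
  apply Rle_trans with (exp (X - 1) * exp (- (INR (S j) ^ 2 * X))).
  - apply Rmult_le_compat_r; [apply Rlt_le, exp_pos|]. generalize (exp_ge_1_plus (X - 1)); lra.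
  - rewrite <- exp_plus. apply exp_le_mono. rewrite S_INR. generalize (pos_INR j); intro.
    destruct j as [|j]; [simpl; nra|]. rewrite S_INR in *. generalize (pos_INR j); intro.
    assert (1 <= (INR j + 1 + 1) ^ 2 - 1) by nra. nra.
Qed.

Section Drift.
Variables (d : nat) (om : vecR) (m : nat -> nat) (k : nat -> nat -> Z) (K rho : nat -> R).
Hypothesis Hd : (2 <= d)%nat.
Hypothesis Hm : forall j, (1 <= m j)%nat.
Hypothesis HR : resonant d om m k K rho.
Hypothesis HF : fast_decay d (fun j => RtoC (rho j)) m k K.
Let lam (j : nat) : R := dotZ d om (k j).

Lemma rho_lt_1 (j : nat) : rho j < 1.
Proof.
  eapply Rle_lt_trans; [apply (res_rho _ _ _ _ _ _ HR)|]. rewrite <- exp_0. apply exp_increasing.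
  generalize (res_K _ _ _ _ _ _ HR j) (pos_INR j). rewrite S_INR. intros. nra.
Qed.

Lemma rho_pow_le (j n : nat) : (1 <= n)%nat -> rho j ^ n <= rho j.
Proof.
  intros Hn. destruct n as [|n]; [lia|]. simpl.
  generalize (res_pos _ _ _ _ _ _ HR j) (rho_lt_1 j); intros.
  assert (rho j ^ n <= 1) by (rewrite <- (pow1 n); apply pow_incr; lra). nra.
Qed.

Lemma lam_le_rho (j : nat) : Rabs (lam j) <= rho j.
Proof.
  generalize (res_small _ _ _ _ _ _ HR j) (rho_pow_le j (m j + 2) ltac:(lia)) (Rabs_pos (lam j)).
  fold (lam j). lra.
Qed.

(** The scales interlace: |λ_j| <= ρ_j by [lam_le_rho], and ρ_j <= |λ_i| by induction, so [res_next]
    propagates from neighbours to all pairs. *)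
Lemma rho_le_lam (i j : nat) : (i < j)%nat ->
  rho j <= Rabs (lam i) * exp (- (INR (S j) ^ 2 * K j)).
Proof.
  intros Hij. induction Hij as [|j Hij IH]; [apply (res_next _ _ _ _ _ _ HR)|].
  apply Rle_trans with (1 := res_next _ _ _ _ _ _ HR j).
  apply Rmult_le_compat_r; [apply Rlt_le, exp_pos|].
  apply Rle_trans with (1 := lam_le_rho j). apply Rle_trans with (1 := IH).
  rewrite <- Rmult_1_r. apply Rmult_le_compat_l; [apply Rabs_pos|].
  rewrite <- exp_0. apply exp_le_mono.
  generalize (res_K _ _ _ _ _ _ HR j) (pow2_ge_0 (INR (S j))). nra.
Qed.

Lemma drift (n : nat) : exists Th Rr : R -> vecR,
  (forall t i, (i < d)%nat ->
    is_derive (fun u => Th u i) t (dr (ham d om (fun j => RtoC (rho j)) m k) i (Th t) (Rr t)) /\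
    is_derive (fun u => Rr u i) t (- dt (ham d om (fun j => RtoC (rho j)) m k) i (Th t) (Rr t))) /\
  normd d (Rr 0) = rho n /\ / rho n <= normd d (Rr (/ rho n ^ (m n + 2))).
Proof.
  destruct (res_max _ _ _ _ _ _ HR n) as [i [Hi HKi]].
  generalize (res_pos _ _ _ _ _ _ HR n) (rho_lt_1 n) (res_K _ _ _ _ _ _ HR n). intros Hr0 Hr1 HKn.
  assert (Hk0 : IZR (k n i) <> 0) by (intros E; rewrite E, Rabs_R0 in HKi; lra).
  (* This angle makes <k_n, th0> = 1/4, so the n-th phase starts at π/2, where the sine is maximal.
     The coordinate [i] carries the norm of k_n, hence |k_(n,i)| = K_n >= 1. *)
  set (th0 := fun l => if Nat.eq_dec l i then / (4 * IZR (k n i)) else 0).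
  exists (orbit_th d om rho m k th0 (rho n)), (orbit_r d om rho m k th0 (rho n)).
  split; [|split].
  - intros t l Hl. apply (orbit_derive d om rho m k K Hd HF (res_last _ _ _ _ _ _ HR)
      (res_lam _ _ _ _ _ _ HR) th0 (rho n) t l Hl).
  - rewrite (normd_axis d (pred d)); [|lia|].
    + unfold orbit_r. destruct (Nat.eq_dec (pred d) (pred d)); [|lia]. apply Rabs_right; lra.
    + intros l Hl Hn. unfold orbit_r. destruct (Nat.eq_dec l (pred d)); [lia|].
      rewrite (Series_ext _ (fun _ => 0 * 0)).
      * rewrite Series_scal_l. ring.
      * intros j. unfold sin_prim, Rdiv. rewrite (Rmult_0_r (2 * PI * dotZ d om (k j))), Rplus_0_r, Rminus_diag. ring.
  - set (T := / rho n ^ (m n + 2)).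
    assert (HT : 0 < T) by (apply Rinv_0_lt_compat, pow_lt, Hr0).
    (* Used twice: the n-th phase moves by at most 2π/16 <= 1/2 up to time T, and the sizes of the
       later modes, below |λ_n|, stay small after multiplication by T. *)
    assert (HlT : 16 * Rabs (lam n) * T <= 1).
    { unfold T. apply Rmult_le_reg_r with (rho n ^ (m n + 2)); [apply pow_lt, Hr0|].
      rewrite Rmult_assoc, Rinv_l, Rmult_1_r, Rmult_1_l by (apply pow_nonzero; lra).
      apply (res_small _ _ _ _ _ _ HR). }
    apply Rle_trans with (2 := coord_le_normd d i _ ltac:(lia)).
    unfold orbit_r. destruct (Nat.eq_dec i (pred d)); [lia|].
    set (al := fun j => 2 * PI * dotZ d th0 (k j)).
    set (be := fun j => 2 * PI * dotZ d om (k j)).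
    set (a := fun j => 2 * PI * IZR (k j i) * rho j * rho n ^ m j * sin_prim (al j) (be j) T).
    change (/ rho n <= Rabs (Series a)).
    assert (Hbe : forall j, be j <> 0) by (intros j; apply be_neq0, (res_lam _ _ _ _ _ _ HR)).
    assert (Hal : al n = PI / 2).
    { unfold al, dotZ. rewrite (rsum_single d i).
      - unfold th0. destruct (Nat.eq_dec i i); [field; exact Hk0|lia].
      - lia.
      - intros l _ Hl. unfold th0. destruct (Nat.eq_dec l i); [lia|ring]. }
    assert (HP : 3 <= PI <= 4) by (generalize PI2_3_2 PI_4; lra).
    assert (Habs : forall j, Rabs (a j) <= 2 * PI * K j * rho j * rho n ^ m j * Rabs (sin_prim (al j) (be j) T)).
    { intros j. unfold a. rewrite !Rabs_mult. apply Rmult_le_compat_r; [apply Rabs_pos|].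
      generalize (res_pos _ _ _ _ _ _ HR j) (pow_lt (rho n) (m j) Hr0). intros.
      rewrite (Rabs_right 2), (Rabs_right PI), (Rabs_right (rho j)), (Rabs_right (rho n ^ m j)) by lra.
      repeat (apply Rmult_le_compat_r; [lra|]).
      apply Rmult_le_compat_l; [lra|apply (res_k _ _ _ _ _ _ HR)]. }
    assert (Hother : forall j, j <> n -> Rabs (a j) <= (1 / 2) ^ j).
    { intros j Hj. apply Rle_trans with (1 := Habs j).
      generalize (res_pos _ _ _ _ _ _ HR j) (res_K _ _ _ _ _ _ HR j) (rho_pow_le n (m j) (Hm j)) (pow_lt (rho n) (m j) Hr0).
      intros Hrj HKj Hrm Hrm0.
      generalize (weight_le j (K j) HKj). simpl ((1 / 2) ^ S j). intro Hw.
      assert (HKr : 0 < K j * rho j) by (apply Rmult_lt_0_compat; lra).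
      destruct (Nat.lt_total j n) as [Hlt|[E|Hgt]]; [|contradiction|].
      (* Earlier modes: the oscillation bound brings in 1/|λ_j|, and the factor ρ_n^(m_j) <= ρ_n <=
         |λ_j| cancels it, leaving 2 K_j ρ_j. *)
      - generalize (sin_prim_le_inv (al j) (be j) T (Hbe j)). intro HS.
        assert (Hl : 0 < Rabs (lam j)) by (apply Rabs_pos_lt, (res_lam _ _ _ _ _ _ HR)).
        assert (Hb : 2 / Rabs (be j) = / (PI * Rabs (lam j))).
        { unfold be. fold (lam j). rewrite !Rabs_mult, (Rabs_right 2), (Rabs_right PI) by lra. field. lra. }
        rewrite Hb in HS.
        assert (Hrl : rho n <= Rabs (lam j)).
        { apply Rle_trans with (1 := rho_le_lam j n Hlt). rewrite <- Rmult_1_r.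
          apply Rmult_le_compat_l; [lra|]. rewrite <- exp_0. apply exp_le_mono.
          generalize (pow2_ge_0 (INR (S n))). nra. }
        assert (HKr1 : K j * rho j <= 1 / 2 * (1 / 2) ^ j).
        { apply Rle_trans with (2 := Hw). apply Rmult_le_compat_l; [lra|]. apply (res_rho _ _ _ _ _ _ HR). }
        apply Rle_trans with (2 * PI * K j * rho j * Rabs (lam j) * / (PI * Rabs (lam j))).
        + apply Rmult_le_compat; try apply Rabs_pos; [|apply Rmult_le_compat_l; [|lra]|exact HS].
          * apply Rmult_le_pos; [|lra]. rewrite !Rmult_assoc. apply Rmult_le_pos; [lra|]. apply Rmult_le_pos; lra.
          * rewrite !Rmult_assoc. apply Rmult_le_pos; [lra|]. apply Rmult_le_pos; lra.
        + replace (_ * / _) with (2 * (K j * rho j)) by (field; lra). lra.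
      (* Later modes: the crude bound T suffices, since ρ_j is at most |λ_n| times a tiny weight and
         |λ_n| T <= 1/16. *)
      - generalize (sin_prim_le (al j) (be j) T (Hbe j)). rewrite (Rabs_right T) by lra. intro HS.
        assert (HKr1 : K j * rho j <= Rabs (lam n) * (1 / 2 * (1 / 2) ^ j)).
        { apply Rle_trans with (Rabs (lam n) * (K j * exp (- (INR (S j) ^ 2 * K j)))).
          - generalize (rho_le_lam n j Hgt). intro. 
            apply Rle_trans with (K j * (Rabs (lam n) * exp (- (INR (S j) ^ 2 * K j)))); [|lra].
            apply Rmult_le_compat_l; lra.
          - apply Rmult_le_compat_l; [apply Rabs_pos|exact Hw]. }
        assert (Hpj : 0 < (1 / 2) ^ j) by (apply pow_lt; lra).
        apply Rle_trans with (8 * (K j * rho j) * T).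
        + apply Rmult_le_compat; try apply Rabs_pos; [|  |exact HS].
          * apply Rmult_le_pos; [|lra]. rewrite !Rmult_assoc. apply Rmult_le_pos; [lra|]. apply Rmult_le_pos; lra.
          * replace (2 * PI * K j * rho j * rho n ^ m j) with ((2 * PI) * (K j * rho j) * rho n ^ m j) by ring.
            rewrite <- (Rmult_1_r (8 * _)). apply Rmult_le_compat; try lra.
            apply Rmult_le_pos; lra. apply Rmult_le_compat_r; lra.
        + apply Rle_trans with (8 * (Rabs (lam n) * (1 / 2 * (1 / 2) ^ j)) * T).
          * apply Rmult_le_compat_r; lra.
          * replace (8 * _ * T) with ((16 * Rabs (lam n) * T) * ((1 / 4) * (1 / 2) ^ j)) by field.
            apply Rle_trans with (1 * (1 / 4 * (1 / 2) ^ j)); [apply Rmult_le_compat_r; lra|lra]. }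
    (* The factor 2π K_n is at least 6, the mode has size ρ_n^(m_n+1), and the primitive is at least
       T/2, whence 3/ρ_n. The other modes sum to at most 2 < 2/ρ_n, so at least 1/ρ_n survives. *)
    assert (Hmain : 3 / rho n <= Rabs (a n)).
    { unfold a. rewrite Hal. set (x := be n * T).
      assert (Hx : Rabs x <= 1 / 2).
      { unfold x, be. fold (lam n). rewrite !Rabs_mult, (Rabs_right 2), (Rabs_right PI), (Rabs_right T) by lra.
        generalize (Rabs_pos (lam n)). intro. 
        assert (PI * (Rabs (lam n) * T) <= 4 * (Rabs (lam n) * T)); [|lra].
        apply Rmult_le_compat_r; [apply Rmult_le_pos; lra|lra]. }
      (* Started at phase π/2, the primitive is sin(x)/be in absolute value, and |sin x| >= |x| -
         x^2 >= |x|/2 for |x| <= 1/2. *)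
      assert (Hs : T / 2 <= Rabs (sin_prim (PI / 2) (be n) T)).
      { unfold sin_prim. fold x. rewrite cos_PI2, <- (Ropp_involutive (cos (PI / 2 + x))), <- sin_cos.
        replace (0 - - sin x) with (sin x) by ring.
        unfold Rdiv. rewrite Rabs_mult, Rabs_inv.
        assert (Hb : 0 < Rabs (be n)) by (apply Rabs_pos_lt, Hbe).
        apply Rmult_le_reg_r with (Rabs (be n)); [exact Hb|].
        rewrite (Rmult_assoc (Rabs (sin x))), Rinv_l, Rmult_1_r by lra.
        replace (T * / 2 * Rabs (be n)) with (Rabs x / 2) by (unfold x; rewrite Rabs_mult, (Rabs_right T) by lra; field).
        generalize (sin_sub_id_le x) (Rabs_triang (sin x) (- (sin x - x))).
        replace (sin x + - (sin x - x)) with x by ring. rewrite Rabs_Ropp, <- (pow2_abs x).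
        generalize (Rabs_pos x). nra. }
      rewrite !Rabs_mult, HKi, (Rabs_right 2), (Rabs_right PI), (Rabs_right (rho n)), (Rabs_right (rho n ^ m n))
        by (try apply Rle_ge, pow_le; lra).
      apply Rle_trans with (2 * 3 * 1 * rho n * rho n ^ m n * (T / 2)).
      - apply Req_le. unfold T. rewrite pow_add. simpl. field.
        generalize (pow_lt (rho n) (m n) Hr0). split; lra.
      - apply Rmult_le_compat; [|lra| |exact Hs].
        + generalize (pow_lt (rho n) (m n) Hr0); intro. repeat apply Rmult_le_pos; lra.
        + apply Rmult_le_compat_r; [apply pow_le; lra|]. apply Rmult_le_compat_r; [lra|].
          apply Rmult_le_compat; lra. }
    assert (Hgeo : is_series (fun j => (1 / 2) ^ j) 2).
    { generalize (is_series_geom (1 / 2) ltac:(rewrite Rabs_right; lra)).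
      replace (/ (1 - 1 / 2)) with 2 by field. auto. }
    generalize (Series_dominant_term n a (fun j => (1 / 2) ^ j) Hother
      (fun j => pow_le (1 / 2) j ltac:(lra)) (ex_intro _ _ Hgeo)).
    rewrite (is_series_unique _ _ Hgeo).
    assert (1 < / rho n) by (rewrite <- Rinv_1; apply Rinv_lt_contravar; lra).
    unfold Rdiv in Hmain. lra.
Qed.

(** The orbit of level ρ_n is admissible for every r >= ρ_n, since it also overshoots the lower
    target 1/r. The case r = ρ_n bounds the time, and arbitrary small r gives diffusivity. *)
Lemma hit_by (n : nat) (r : R) : rho n <= r < 1 ->
  exists t, 0 < t <= / rho n ^ (m n + 2) /\ hit_times d (ham d om (fun j => RtoC (rho j)) m k) r t.
Proof.
  intros Hr. destruct (drift n) as [Th [Rr (HD & H0 & H1)]].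
  generalize (res_pos _ _ _ _ _ _ HR n); intro Hp.
  apply (hit_of_orbit d _ Th Rr); [exact HD|lra| |lra|].
  - apply Rinv_0_lt_compat, pow_lt, Hp.
  - apply Rle_trans with (2 := H1). apply Rinv_le_contravar; lra.
Qed.

Lemma rho_le_half_pow (n : nat) : rho n <= (1 / 2) ^ S n.
Proof.
  generalize (res_K _ _ _ _ _ _ HR n). intro HK.
  apply Rle_trans with (1 := res_rho _ _ _ _ _ _ HR n).
  apply Rle_trans with (2 := weight_le n (K n) HK).
  rewrite <- (Rmult_1_l (exp _)) at 1. apply Rmult_le_compat_r; [apply Rlt_le, exp_pos|exact HK].
Qed.

Lemma rho_lim : is_lim_seq rho 0.
Proof.
  apply is_lim_seq_le_le with (fun _ => 0) (fun n => (1 / 2) ^ S n).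
  - intros n. split; [apply Rlt_le, (res_pos _ _ _ _ _ _ HR)|apply rho_le_half_pow].
  - apply is_lim_seq_const.
  - apply (is_lim_seq_incr_1 (fun n => (1 / 2) ^ n)). apply is_lim_seq_geom. rewrite Rabs_right; lra.
Qed.

Lemma diffusive_ham : diffusive d (ham d om (fun j => RtoC (rho j)) m k).
Proof.
  exists 1. split; [lra|]. intros r Hr.
  destruct (rho_lim (fun x => x < r)) as [N HN].
  { exists (mkposreal r (proj1 Hr)). intros y Hy. change (Rabs (y - 0) < r) in Hy.
    rewrite Rminus_0_r in Hy. generalize (Rle_abs y). lra. }
  specialize (HN N (Nat.le_refl N)). simpl in HN.
  destruct (hit_by N r ltac:(lra)) as [t [_ Ht]]. exists t. exact Ht.
Qed.

Lemma Tdiff_ham_le (n : nat) :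
  Tdiff d (ham d om (fun j => RtoC (rho j)) m k) (rho n) <= / rho n ^ (m n + 2).
Proof.
  destruct (hit_by n (rho n)) as [t [Ht Hh]].
  - generalize (rho_lt_1 n). lra.
  - generalize (Tdiff_le _ _ _ _ Hh). lra.
Qed.

End Drift.

(** * Choice of the resonances *)

Lemma maxnormZ_ge (d : nat) (k : nat -> Z) (i : nat) : (i < d)%nat -> Rabs (IZR (k i)) <= maxnormZ d k.
Proof.
  rewrite <- abs_IZR. induction d as [|d IH]; intros Hi; [lia|]. simpl.
  destruct (Nat.eq_dec i d) as [->|Hn]; [apply Rmax_r|].
  eapply Rle_trans; [apply IH; lia|apply Rmax_l].
Qed.

Lemma maxnormZ_attained (d : nat) (k : nat -> Z) : (0 < d)%nat ->
  exists i, (i < d)%nat /\ Rabs (IZR (k i)) = maxnormZ d k.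
Proof.
  induction d as [|d IH]; intros Hd; [lia|]. simpl. destruct d as [|d].
  - exists O. split; [lia|]. simpl. rewrite <- abs_IZR, Rmax_right; [reflexivity|].
    apply IZR_le. lia.
  - destruct (IH ltac:(lia)) as [i [Hi E]].
    destruct (Rle_dec (maxnormZ (S d) k) (IZR (Z.abs (k (S d))))) as [Hl|Hg].
    + exists (S d). split; [lia|]. rewrite Rmax_right, <- abs_IZR; [reflexivity|exact Hl].
    + exists i. split; [lia|]. rewrite Rmax_left by lra. exact E.
Qed.

Lemma maxnormZ_ge_1 (d : nat) (k : nat -> Z) : nonzeroZ d k -> 1 <= maxnormZ d k.
Proof.
  intros [i [Hi Hk]]. apply Rle_trans with (2 := maxnormZ_ge d k i Hi).
  rewrite <- abs_IZR. apply (IZR_le 1). lia.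
Qed.

(** Padding by zeros at every index from n on, and not only at n, makes the bound [res_k] hold for
    all indices. *)
Definition lift0 (n : nat) (k : nat -> Z) : nat -> Z := fun i => if lt_dec i n then k i else 0%Z.

Lemma dotZ_lift0 (n : nat) (w : vecR) (k : nat -> Z) : dotZ (S n) w (lift0 n k) = dotZ n w k.
Proof.
  unfold dotZ. simpl. rewrite (rsum_ext n _ (fun i => w i * IZR (k i))).
  - unfold lift0. destruct (lt_dec n n); [lia|]. ring.
  - intros i Hi. unfold lift0. destruct (lt_dec i n); [reflexivity|lia].
Qed.

(** In the exponent, (j+1)^2 K_j is quadratic in j, while B^(m_j) contributes at most B(j+2) and the
    weight L K_j. The former wins once j >= 2B + L, and what remains is below exp(-j). *)
Lemma fast_decay_resonant (d : nat) (om : vecR) (m : nat -> nat) (k : nat -> nat -> Z)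
    (K rho : nat -> R) : (forall j, (m j <= j + 2)%nat) -> resonant d om m k K rho ->
  fast_decay d (fun j => RtoC (rho j)) m k K.
Proof.
  intros Hm HR. split; [|split].
  - intros j. generalize (res_K _ _ _ _ _ _ HR j). lra.
  - intros j i _. apply (res_k _ _ _ _ _ _ HR).
  - intros B L HB HL. set (M := 2 * B + L). 
    destruct (nfloor_ex (M + 1)) as [N [_ HN]]; [unfold M; lra|].
    apply (ex_series_incr_n _ N).
    apply ex_series_dominated with (fun j => (1 / 2) ^ (N + j)).
    + intros j'. set (j := (N + j')%nat).
      assert (HMj : M <= INR j).
      { unfold j. rewrite plus_INR. generalize (pos_INR j'). lra. }
      generalize (res_K _ _ _ _ _ _ HR j) (res_pos _ _ _ _ _ _ HR j). intros HK Hp.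
      assert (HB0 : 0 < B ^ m j) by (apply pow_lt; lra).
      rewrite Cmod_R, (Rabs_right (rho j)), Rabs_right by
        (try apply Rle_ge, Rmult_le_pos; try apply Rlt_le, exp_pos; try apply Rmult_le_pos; lra).
      apply Rle_trans with (2 := half_pow_ge j).
      apply Rle_trans with (exp (- (INR (S j) ^ 2 * K j)) * exp (B * INR (j + 2) ) * exp (L * K j)).
      * apply Rmult_le_compat_r; [apply Rlt_le, exp_pos|].
        apply Rmult_le_compat; try lra. apply (res_rho _ _ _ _ _ _ HR).
        apply Rle_trans with (exp B ^ m j).
        -- apply pow_incr. split; [lra|]. generalize (exp_ge_1_plus B). lra.
        -- apply Rle_trans with (exp B ^ (j + 2)).
           ++ apply Rle_pow; [|apply Hm]. generalize (exp_ge_1_plus B). lra.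
           ++ rewrite <- Rpower_pow by apply exp_pos. unfold Rpower. rewrite ln_exp. apply Req_le. f_equal. ring.
      * rewrite <- !exp_plus. apply exp_le_mono. rewrite plus_INR, S_INR. simpl (INR 2).
        generalize (pos_INR j); intro.
        assert (B * (INR j + 2) <= 2 * B * (INR j + 1) * K j).
        { apply Rle_trans with (2 * B * (INR j + 1) * 1); [nra|].
          apply Rmult_le_compat_l; [|lra]. apply Rmult_le_pos; lra. }
        assert (0 <= L * INR j * K j) by (repeat apply Rmult_le_pos; lra).
        assert (0 <= INR j * (K j - 1)) by (apply Rmult_le_pos; lra).
        assert (M * ((INR j + 1) * K j) <= INR j * ((INR j + 1) * K j)).
        { apply Rmult_le_compat_r; [|exact HMj]. apply Rmult_le_pos; lra. }
        unfold M in *. simpl. lra.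
    + apply (ex_series_incr_n (fun n => (1 / 2) ^ n)). apply ex_series_geom. rewrite Rabs_right; lra.
Qed.

Lemma resonant_exists (n : nat) (om : vecR) (m : nat -> nat) : (0 < n)%nat ->
  nonresonant (S n) om ->
  (exists kb : nat -> (nat -> Z),
      (forall j, nonzeroZ n (kb j)) /\
      is_lim_seq (fun j => ln (Rabs (dotZ n om (kb j))) / maxnormZ n (kb j)) m_infty) ->
  exists k K rho, resonant (S n) om m k K rho.
Proof.
  intros Hn Hnr [kb [Hkb Hlim]].
  assert (Hpick : forall A, exists j, ln (Rabs (dotZ n om (kb j))) < - A * maxnormZ n (kb j)).
  { intros A. destruct (proj2 (is_lim_seq_spec _ _) Hlim (- A)) as [N HN].
    exists N. specialize (HN N (Nat.le_refl N)). simpl in HN.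
    generalize (maxnormZ_ge_1 n _ (Hkb N)); intro.
    apply Rmult_lt_reg_r with (/ maxnormZ n (kb N)); [apply Rinv_0_lt_compat; lra|].
    rewrite Rmult_assoc, Rinv_r, Rmult_1_r by lra. exact HN. }
  (* The rates are defined by recursion through the chosen frequencies, so an actual function of the
     rate is needed, and choice supplies it. *)
  set (pick := fun A => proj1_sig (constructive_indefinite_description _ (Hpick A))).
  assert (Hp : forall A, ln (Rabs (dotZ n om (kb (pick A)))) < - A * maxnormZ n (kb (pick A))).
  { intros A. unfold pick. exact (proj2_sig (constructive_indefinite_description _ (Hpick A))). }
  clearbody pick.
  set (lm := fun j => Rabs (dotZ n om (kb j))).
  (* [ex j] is the rate in ρ_j = exp(-ex_j K_j), fixed before k_j. The index is then picked at rate
     (m_j+2) ex_j + 16, and its divisor enters the next rate. *)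
  set (ex := fix ex (j : nat) : R := match j with
      | O => 1
      | S j' => INR (S (S j')) ^ 2 - ln (lm (pick (INR (m j' + 2) * ex j' + 16))) end).
  set (ix := fun j => pick (INR (m j + 2) * ex j + 16)).
  set (Kj := fun j => maxnormZ n (kb (ix j))).
  assert (HK : forall j, 1 <= Kj j) by (intros j; apply maxnormZ_ge_1, Hkb).
  assert (Hl0 : forall j, 0 < lm j).
  { intros j. unfold lm. apply Rabs_pos_lt. rewrite <- dotZ_lift0. apply Hnr.
    destruct (Hkb j) as [i [Hi Hk]]. exists i. split; [lia|]. unfold lift0. destruct (lt_dec i n); [exact Hk|lia]. }
  (* The lower bound on the rate has to be inductive: a nonnegative rate makes the logarithm of the
     divisor nonpositive, and subtracting it keeps the next rate above (j+2)^2. *)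
  assert (Hex : forall j, INR (S j) ^ 2 <= ex j /\ ln (lm (ix j)) <= - (INR (m j + 2) * ex j + 16) * Kj j).
  { intros j.
    assert (A : INR (S j) ^ 2 <= ex j -> ln (lm (ix j)) <= - (INR (m j + 2) * ex j + 16) * Kj j)
      by (intros _; apply Rlt_le, (Hp (INR (m j + 2) * ex j + 16))).
    induction j as [|j IH].
    - assert (INR 1 ^ 2 <= ex O) by (simpl; lra). auto.
    - assert (B : INR (S (S j)) ^ 2 <= ex (S j)).
      { destruct IH as [H1 H2]; [intros _; apply Rlt_le, (Hp (INR (m j + 2) * ex j + 16))|].
        change (ex (S j)) with (INR (S (S j)) ^ 2 - ln (lm (ix j))).
        assert (0 <= (INR (m j + 2) * ex j + 16) * Kj j); [|lra].
        generalize (pow2_ge_0 (INR (S j))) (pos_INR (m j + 2)) (HK j). intros.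
        apply Rmult_le_pos; [|lra]. assert (0 <= INR (m j + 2) * ex j) by (apply Rmult_le_pos; lra). lra. }
      auto. }
  exists (fun j => lift0 n (kb (ix j))), Kj, (fun j => exp (- (ex j * Kj j))).
  constructor; cbv beta.
  - intros j. simpl. unfold lift0. destruct (lt_dec n n); [lia|reflexivity].
  - exact HK.
  - intros j i. unfold lift0. destruct (lt_dec i n) as [Hi|Hi].
    + apply maxnormZ_ge, Hi.
    + rewrite Rabs_R0. generalize (HK j). lra.
  - intros j. destruct (maxnormZ_attained n (kb (ix j)) Hn) as [i [Hi E]]. exists i.
    split; [exact Hi|]. unfold lift0. destruct (lt_dec i n); [exact E|lia].
  - intros j. rewrite dotZ_lift0. intros E. generalize (Hl0 (ix j)). unfold lm. rewrite E, Rabs_R0. lra.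
  - intros j. apply exp_pos.
  - intros j. apply exp_le_mono. destruct (Hex j) as [H _].
    assert (INR (S j) ^ 2 * Kj j <= ex j * Kj j); [|lra].
    apply Rmult_le_compat_r; [generalize (HK j); lra|exact H].
  - intros j. rewrite dotZ_lift0. fold (lm (ix j)). rewrite <- (exp_ln (lm (ix j))) by apply Hl0.
    rewrite <- Rpower_pow by apply exp_pos. unfold Rpower. rewrite ln_exp.
    destruct (Hex j) as [_ H].
    (* The 16 added to the rate pays for the factor 16 of [res_small]: 16 <= exp 16 <= exp(16 K_j),
       since K_j >= 1. *)
    apply Rle_trans with (exp 16 * exp (ln (lm (ix j)))).
    + apply Rmult_le_compat_r; [apply Rlt_le, exp_pos|]. generalize (exp_ge_1_plus 16). lra.
    + rewrite <- exp_plus. apply exp_le_mono. generalize (HK j). lra.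
  - intros j. rewrite dotZ_lift0. fold (lm (ix j)). rewrite <- (exp_ln (lm (ix j))) at 1 by apply Hl0.
    rewrite <- exp_plus. apply exp_le_mono.
    change (ex (S j)) with (INR (S (S j)) ^ 2 - ln (lm (ix j))).
    destruct (Hex j) as [H1 H2]. 
    (* The rate puts K_(j+1) ln|λ_j| in the exponent; as the logarithm is nonpositive and K_(j+1) >=
       1, this is at most ln|λ_j|. *)
    assert (Hneg : ln (lm (ix j)) <= 0).
    { apply Rle_trans with (1 := H2). generalize (pow2_ge_0 (INR (S j))) (pos_INR (m j + 2)) (HK j). intros.
      assert (0 <= INR (m j + 2) * ex j) by (apply Rmult_le_pos; lra). nra. }
    generalize (HK (S j)). nra.
Qed.

(** * Birkhoff normal form *)

Fixpoint zerob (n : nat) (j : nat -> nat) : bool :=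
  match n with O => true | S n' => andb (zerob n' j) (Nat.eqb (j n') 0) end.

Lemma zerob_agree (n : nat) (j j' : nat -> nat) : agree n j j' -> zerob n j = zerob n j'.
Proof.
  induction n as [|n IH]; simpl; intros H; [reflexivity|].
  rewrite IH, H; [reflexivity|lia|intros i Hi; apply H; lia].
Qed.

Lemma lsum_ext {T : Type} (l : list T) (F G : T -> R) :
  (forall x, In x l -> F x = G x) -> lsum l F = lsum l G.
Proof.
  induction l as [|x l IH]; simpl; intros H; [reflexivity|].
  rewrite (H x), IH; auto.
Qed.

Lemma lsum_zero {T : Type} (l : list T) (F : T -> R) : (forall x, F x = 0) -> lsum l F = 0.
Proof. intros H. induction l as [|x l IH]; simpl; [reflexivity|]. rewrite IH, H. ring. Qed.

Lemma lsum_app {T : Type} (l l' : list T) (F : T -> R) : lsum (l ++ l') F = lsum l F + lsum l' F.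
Proof. induction l as [|x l IH]; simpl; [ring|]. rewrite IH. ring. Qed.

Lemma lsum_map {T U : Type} (h : T -> U) (l : list T) (F : U -> R) :
  lsum (map h l) F = lsum l (fun x => F (h x)).
Proof. induction l as [|x l IH]; simpl; [reflexivity|]. rewrite IH. reflexivity. Qed.

Lemma lsum_flat_map {T U : Type} (f : T -> list U) (l : list T) (F : U -> R) :
  lsum (flat_map f l) F = lsum l (fun x => lsum (f x) F).
Proof. induction l as [|x l IH]; simpl; [reflexivity|]. rewrite lsum_app, IH. reflexivity. Qed.

Lemma lsum_scal {T : Type} (a : R) (l : list T) (F : T -> R) :
  lsum l (fun x => a * F x) = a * lsum l F.
Proof. induction l as [|x l IH]; simpl; [ring|]. rewrite IH. ring. Qed.

Lemma rsum_lsum {T : Type} (n : nat) (l : list T) (F : nat -> T -> R) :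
  rsum n (fun i => lsum l (F i)) = lsum l (fun x => rsum n (fun i => F i x)).
Proof.
  induction l as [|x l IH]; simpl.
  - rewrite (rsum_ext n _ (fun _ => 0 * 0 + 0 * 0)) by (intros; ring). rewrite (rsum_lin n 0 0 (fun _ => 0) (fun _ => 0)). ring.
  - rewrite <- IH, (rsum_ext n _ (fun i => 1 * F i x + 1 * lsum l (F i))) by (intros; ring).
    rewrite rsum_lin. ring.
Qed.

Lemma lsum_seq_sum (N : nat) (F : nat -> R) : lsum (seq 0 (S N)) F = sum_f_R0 F N.
Proof.
  induction N as [|N IH].
  - simpl. ring.
  - rewrite seq_S, lsum_app, IH. simpl. ring.
Qed.

Lemma mindices_S (d N : nat) (G : (nat -> nat) -> R) :
  lsum (mindices (S d) N) G =
  lsum (seq 0 (S N)) (fun p => lsum (mindices d (N - p)) (fun j => G (upd j d p))).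
Proof.
  change (mindices (S d) N) with
    (flat_map (fun k => map (fun j => upd j d k) (mindices d (N - k))) (seq 0 (S N))).
  rewrite lsum_flat_map. apply lsum_ext. intros p _. apply lsum_map.
Qed.

Lemma upd_agree (n : nat) (j : nat -> nat) (p : nat) : agree n (upd j n p) j.
Proof. intros i Hi. apply upd_other. lia. Qed.

Lemma lsum_mindices_zero (n N : nat) (G : (nat -> nat) -> R) :
  (forall j, zerob n j = false -> G j = 0) ->
  (forall j j', agree n j j' -> G j = G j') ->
  lsum (mindices n N) G = G (fun _ => O).
Proof.
  revert N G. induction n as [|n IH]; intros N G Hz Ha.
  - simpl. ring.
  - rewrite mindices_S, lsum_seq_sum.
    assert (E : forall p, lsum (mindices n (N - p)) (fun j => G (upd j n p)) = if Nat.eqb p 0 then G (fun _ => O) else 0).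
    { intros p. destruct p as [|p]; simpl Nat.eqb; cbv iota.
      - rewrite IH.
        + apply Ha. intros i _. unfold upd. destruct (Nat.eq_dec i n); reflexivity.
        + intros j Hj. apply Hz. simpl. rewrite (zerob_agree n _ j) by apply upd_agree. rewrite Hj. reflexivity.
        + intros j j' Hj. apply Ha. intros i Hi. unfold upd. destruct (Nat.eq_dec i n); [reflexivity|apply Hj; lia].
      - apply lsum_zero. intros j. apply Hz. simpl. rewrite upd_same. apply Bool.andb_false_r. }
    rewrite (sum_eq _ (fun p => if Nat.eqb p 0 then G (fun _ => O) else 0)) by (intros; apply E).
    clear. induction N as [|N IH]; simpl; [reflexivity|]. simpl in IH. rewrite IH. ring.
Qed.

(** The outer loop of [mindices] runs over the last exponent, and under it only the zero multi-index
    of the other variables contributes. The multivariate truncation thus becomes a polynomial in one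
    action. *)
Lemma lsum_mindices_axis (n N : nat) (G : (nat -> nat) -> R) :
  (forall j, zerob n j = false -> G j = 0) ->
  (forall j j', agree (S n) j j' -> G j = G j') ->
  lsum (mindices (S n) N) G = sum_f_R0 (fun p => G (upd (fun _ => O) n p)) N.
Proof.
  intros Hz Ha. rewrite mindices_S, lsum_seq_sum. apply sum_eq. intros p _.
  rewrite (lsum_mindices_zero n (N - p) (fun j => G (upd j n p))); [reflexivity| |].
  - intros j Hj. apply Hz. rewrite (zerob_agree n _ j) by apply upd_agree. exact Hj.
  - intros j j' Hj. apply Ha. intros i Hi. unfold upd. destruct (Nat.eq_dec i n); [reflexivity|apply Hj; lia].
Qed.

Lemma dotZ_upd (d : nat) (th : vecR) (k : nat -> Z) (i : nat) (t : R) : (i < d)%nat ->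
  dotZ d (upd th i t) k = dotZ d th k + IZR (k i) * (t - th i).
Proof.
  intros Hi. generalize (dot_upd d (fun l => IZR (k l)) th i t Hi). unfold dot, dotZ.
  rewrite (rsum_ext d (fun l => upd th i t l * IZR (k l)) (fun l => IZR (k l) * upd th i t l)) by (intros; ring).
  rewrite (rsum_ext d (fun l => th l * IZR (k l)) (fun l => IZR (k l) * th l)) by (intros; ring). auto.
Qed.

Lemma rsum_scal_r (n : nat) (f : nat -> R) (a : R) : rsum n (fun i => f i * a) = rsum n f * a.
Proof. induction n as [|n IH]; simpl; [ring|]. rewrite IH. ring. Qed.

Section NormalForm.
Variables (n : nat) (om : vecR) (k : nat -> nat -> Z) (K rho : nat -> R).
Let d := S n.
Let m := fun j : nat => (j + 2)%nat.
Hypothesis Hlast : forall j, k j n = 0%Z.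
Hypothesis Hlam : forall j, dotZ d om (k j) <> 0.
Hypothesis Hpos : forall j, 0 < rho j.
Hypothesis HF : fast_decay d (fun j => RtoC (rho j)) m k K.

(* Coefficient of r^j in the generating function: nonzero only for pure powers of the last action. *)
Definition gen_coef (j : nat -> nat) (th : vecR) : R :=
  if zerob n j then
    match j n with
    | S (S l) => - rho l / (2 * PI * dotZ d om (k l)) * sin (2 * PI * dotZ d th (k l))
    | _ => 0
    end
  else 0.

(** Differentiating the sine cancels the 2π of [gen_coef]; only the divisor λ_l and the frequency
    component remain. *)
Definition gen_coef_dth (p i : nat) (th : vecR) : R :=
  match p with
  | S (S l) => - (rho l * cos (2 * PI * dotZ d th (k l)) / dotZ d om (k l)) * IZR (k l i)
  | _ => 0
  end.

Lemma gen_coef_agree (j j' : nat -> nat) (th : vecR) : agree d j j' -> gen_coef j th = gen_coef j' th.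
Proof.
  intros H. unfold gen_coef. rewrite (zerob_agree n j j') by (intros i Hi; apply H; unfold d; lia).
  rewrite (H n) by (unfold d; lia). reflexivity.
Qed.

Lemma dth_gen_coef (p i : nat) (th : vecR) : (i < d)%nat ->
  dth (gen_coef (upd (fun _ => O) n p)) i th = gen_coef_dth p i th.
Proof.
  intros Hi. unfold dth, gen_coef. rewrite upd_same.
  assert (E : zerob n (upd (fun _ => O) n p) = true).
  { rewrite (zerob_agree n _ (fun _ => O)) by apply upd_agree.
    clear. induction n as [|n' IH]; [reflexivity|]. simpl. rewrite IH. reflexivity. }
  rewrite E. destruct p as [|[|l]]; try apply Derive_const. simpl gen_coef_dth.
  apply is_derive_unique.
  apply is_derive_ext with (f := fun t => - rho l / (2 * PI * dotZ d om (k l)) *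
      sin (2 * PI * (dotZ d th (k l) + IZR (k l i) * (t - th i)))).
  - intros t. rewrite dotZ_upd by exact Hi. reflexivity.
  - auto_derive; auto. replace (th i + - th i) with 0 by ring. rewrite Rmult_0_r, Rplus_0_r. field.
    split; [apply Hlam|]. generalize PI_RGT_0; lra.
Qed.

Lemma mono_axis (p : nat) (r : vecR) : mono d r (upd (fun _ => O) n p) = r n ^ p.
Proof.
  unfold mono, d. simpl. rewrite upd_same.
  assert (E : forall n', (n' <= n)%nat -> rprod n' (fun i => r i ^ upd (fun _ => O) n p i) = 1).
  { induction n' as [|n' IH]; simpl; intros H; [reflexivity|]. rewrite IH, upd_other by lia. simpl. ring. }
  rewrite E by lia. ring.
Qed.

Lemma dth_trunc_gen (N i : nat) (th r : vecR) : (i < d)%nat ->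
  dth_trunc d N gen_coef i th r = sum_f_R0 (fun p => gen_coef_dth p i th * r n ^ p) N.
Proof.
  intros Hi. unfold dth_trunc. unfold d at 1. rewrite lsum_mindices_axis.
  - apply sum_eq. intros p _. rewrite dth_gen_coef, mono_axis by exact Hi. reflexivity.
  - intros j Hj. unfold dth, gen_coef. rewrite Hj, Derive_const. ring.
  - intros j j' Hj. f_equal.
    + unfold dth. apply Derive_ext. intros t. apply gen_coef_agree, Hj.
    + unfold mono. fold d in Hj. clear - Hj. revert Hj. generalize d. induction d0 as [|d0 IH]; simpl; intros Hj; [reflexivity|].
      rewrite (Hj d0), IH by (try lia; intros i Hi; apply Hj; lia). reflexivity.
Qed.

(** The substitution leaves r_d unchanged, because no frequency has a last component. The nonlinear
    part is therefore not modified, and <ω, ∂_θ f_N> cancels its terms of order at most N exactly,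
    with no higher corrections. Only the tail from order N+1 on remains. *)
Lemma bnf_ham : bnf_is_linear d om (ham d om (fun j => RtoC (rho j)) m k).
Proof.
  exists gen_coef. split; [|split].
  - intros j. unfold gen_coef.
    assert (Hz : real_analytic_T d (fun _ => 0)).
    { destruct (real_analytic_trig d (fun _ => 0%Z) 0 0 ltac:(unfold d; lia)) as [s [Hs [A (H1 & H2 & H3 & H4)]]].
      exists s. split; [exact Hs|]. exists A. repeat split; auto; try apply H3. intros th. rewrite H4. f_equal. ring. }
    destruct (zerob n j); [|exact Hz]. destruct (j n) as [|[|l]]; try exact Hz.
    destruct (real_analytic_trig d (k l) 0 (- rho l / (2 * PI * dotZ d om (k l))) ltac:(unfold d; lia))
      as [s [Hs [A (H1 & H2 & H3 & H4)]]].
    exists s. split; [exact Hs|]. exists A. repeat split; auto; try apply H3. intros th. rewrite H4. f_equal. ring.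
  - intros j Hj th. unfold gen_coef. destruct (zerob n j); [|reflexivity].
    unfold d in Hj. simpl in Hj. destruct (j n) as [|[|l]]; try reflexivity. lia.
  - intros N th.
    set (Cs := fun l => rho l * cos (2 * PI * dotZ d th (k l))).
    (* [rho] reindexed by the power of the last action, l + 2 in place of l, so that the tail after
       truncation starts at the index N + 1. Its sum is the constant of the remainder on |r| < 1. *)
    set (sg := fun p => match p with S (S l) => rho l | _ => 0 end).
    assert (Hrho : ex_series rho).
    { apply ex_series_ext with (2 := fast_decay_at d _ m k K 1 0 HF (Rle_refl 0)). intros j.
      rewrite Cmod_R, Rabs_R1, pow1, Rmult_0_l, exp_0, Rabs_right by (apply Rle_ge, Rlt_le, Hpos).
      match goal with |- @eq _ ?x ?y => change (@eq R x y) end. ring. }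
    assert (Hsg : ex_series (fun q => sg (S N + q)%nat)).
    { apply (ex_series_incr_n sg (S N)). apply (ex_series_incr_n sg 2). exact Hrho. }
    exists (Series (fun q => sg (S N + q)%nat)), 1. split; [lra|]. intros r Hr.
    set (u := r n).
    assert (Hu : Rabs u <= normd d r) by (apply coord_le_normd; unfold d; lia).
    set (e := fun p => match p with S (S l) => Cs l * u ^ p | _ => 0 end).
    (* Summing ω_i k_(l,i) over i rebuilds λ_l, which cancels the divisor in the coefficient: this
       is the homological equation at each order. *)
    assert (Hdot : dot d om (fun i => r i + dth_trunc d N gen_coef i th r) = dot d om r - sum_f_R0 e N).
    { unfold dot. rewrite (rsum_ext d _ (fun i => 1 * (om i * r i) + 1 * (lsum (seq 0 (S N))
          (fun p => om i * (gen_coef_dth p i th * u ^ p))))).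
      - rewrite rsum_lin, rsum_lsum, lsum_seq_sum.
        rewrite (sum_eq _ (fun p => e p * -1)), <- scal_sum by
         (intros [|[|l]] _; simpl gen_coef_dth; unfold e;
          [rewrite (rsum_ext d _ (fun i => om i * 0)), rsum_scal_r by (intros; ring); ring
          |rewrite (rsum_ext d _ (fun i => om i * 0)), rsum_scal_r by (intros; ring); ring
          |rewrite (rsum_ext d _ (fun i => (om i * IZR (k l i)) * (- (Cs l / dotZ d om (k l)) * u ^ S (S l)))), rsum_scal_r by
             (intros; unfold Cs; ring); fold (dotZ d om (k l)); field; apply Hlam]).
        ring.
      - intros i Hi. rewrite dth_trunc_gen by exact Hi. rewrite lsum_scal, lsum_seq_sum. fold u. ring. }
    assert (Hlst : dth_trunc d N gen_coef n th r = 0).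
    { rewrite dth_trunc_gen by (unfold d; lia). rewrite (sum_eq _ (fun _ => 0 * 0)), <- scal_sum; [ring|].
      intros [|[|l]] _; simpl gen_coef_dth; [ring|ring|]. rewrite Hlast. ring. }
    unfold ham. rewrite Hdot.
    rewrite (rwave_agree d _ m k th th _ r) by
      first [intros i _; reflexivity | change (r n + dth_trunc d N gen_coef n th r = r n); rewrite Hlst; ring].
    rewrite rwave_series.
    assert (Hu1 : Rabs u <= 1) by lra.
    assert (He : forall p, Rabs (e p) <= sg p * Rabs u ^ p).
    { intros [|[|l]]; unfold e, sg; try (rewrite Rabs_R0; lra). 
      unfold Cs. rewrite !Rabs_mult, <- RPow_abs, (Rabs_right (rho l)) by (apply Rle_ge, Rlt_le, Hpos).
      apply Rmult_le_compat_r; [apply pow_le, Rabs_pos|]. rewrite <- (Rmult_1_r (rho l)) at 2.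
      apply Rmult_le_compat_l; [apply Rlt_le, Hpos|]. apply Rabs_le, COS_bound. }
    assert (Hsg0 : forall p, 0 <= sg p) by (intros [|[|l]]; unfold sg; try lra; apply Rlt_le, Hpos).
    assert (Hex : ex_series e).
    { apply ex_series_dominated with sg.
      - intros p. apply Rle_trans with (1 := He p). rewrite <- (Rmult_1_r (sg p)) at 2.
        apply Rmult_le_compat_l; [apply Hsg0|]. rewrite <- (pow1 p). apply pow_incr. split; [apply Rabs_pos|exact Hu1].
      - apply (ex_series_incr_n sg (S N)). exact Hsg. }
    assert (ES : Series (rterm d (fun j => RtoC (rho j)) m k th r) = Series e).
    { rewrite (Series_incr_n e 2 ltac:(lia) Hex). simpl sum_f_R0. rewrite !Rplus_0_l.
      apply Series_ext. intros l. unfold rterm, e, m, Cs, d, RtoC. simpl pred. simpl fst; simpl snd.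
      replace (l + 2)%nat with (S (S l)) by lia. fold u. cbn [Nat.add]. ring. }
    rewrite ES, (Series_incr_n e (S N) ltac:(lia) Hex). simpl pred.
    replace (_ - _) with (Series (fun q => e (S N + q)%nat)) by ring.
    apply Rle_trans with (Series (fun q => sg (S N + q)%nat * normd d r ^ S N)).
    + apply Series_abs_le.
      * intros q. apply Rle_trans with (1 := He _). apply Rmult_le_compat_l; [apply Hsg0|].
        apply Rle_trans with (Rabs u ^ S N).
        -- rewrite pow_add, <- Rmult_1_r. apply Rmult_le_compat_l; [apply pow_le, Rabs_pos|].
           rewrite <- (pow1 q). apply pow_incr. split; [apply Rabs_pos|exact Hu1].
        -- apply pow_incr. split; [apply Rabs_pos|exact Hu].
      * apply ex_series_scal_r, Hsg.
    + rewrite Series_scal_r. lra.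
Qed.
End NormalForm.

(** * Quadratic remainder and the two choices of exponents *)

Lemma linear_plus_O2_ham (d : nat) (om : vecR) (rho : nat -> R) (m : nat -> nat)
    (k : nat -> nat -> Z) (K : nat -> R) : (0 < d)%nat -> (forall j, (2 <= m j)%nat) ->
  fast_decay d (fun j => RtoC (rho j)) m k K ->
  linear_plus_O2 d om (ham d om (fun j => RtoC (rho j)) m k).
Proof.
  intros Hd Hm HF.
  assert (Hrho : ex_series (fun j => Rabs (rho j))).
  { apply ex_series_ext with (2 := fast_decay_at d _ m k K 1 0 HF (Rle_refl 0)). intros j.
    rewrite Cmod_R, Rabs_R1, pow1, Rmult_0_l, exp_0.
    match goal with |- @eq _ ?x ?y => change (@eq R x y) end. ring. }
  exists (Series (fun j => Rabs (rho j))), 1. split; [lra|]. intros th r Hr.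
  unfold ham. replace (_ - _) with (rwave d (fun j => RtoC (rho j)) m k th r) by ring.
  rewrite rwave_series, <- Series_scal_r. apply Series_abs_le; [|apply ex_series_scal_r, Hrho].
  intros j. unfold rterm, RtoC. simpl fst; simpl snd. rewrite Rmult_0_l, Rminus_0_r, !Rabs_mult, <- RPow_abs.
  set (u := r (pred d)).
  assert (Hu : Rabs u <= normd d r) by (apply coord_le_normd; lia).
  generalize (Rabs_pos u) (Rabs_pos (rho j)). intros.
  rewrite Rmult_comm. apply Rmult_le_compat; try lra.
  - apply Rmult_le_pos; apply Rabs_pos.
  - apply pow_le; lra.
  - rewrite <- Rmult_1_r. apply Rmult_le_compat_l; [lra|]. apply Rabs_le, COS_bound.
  - replace (m j) with (2 + (m j - 2))%nat by (generalize (Hm j); lia). rewrite pow_add.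
    rewrite <- (Rmult_1_r (normd d r ^ 2)). apply Rmult_le_compat; try (apply pow_le; lra).
    + apply pow_incr; lra.
    + rewrite <- (pow1 (m j - 2)). apply pow_incr; lra.
Qed.

Theorem theoremD :
  forall (d : nat) (w : vecR),
    (3 <= d)%nat ->
    nonresonant d w ->
    (exists kb : nat -> (nat -> Z),
        (forall j, nonzeroZ (d - 1) (kb j)) /\
        is_lim_seq (fun j => ln (Rabs (dotZ (d - 1) w (kb j))) / maxnormZ (d - 1) (kb j))
                   m_infty) ->
    (exists H : vecR -> vecR -> R,
        real_entire d H /\ linear_plus_O2 d w H /\ bnf_is_linear d w H /\
        diffusive d H /\
        exists rn : nat -> R, (forall n, 0 < rn n) /\ is_lim_seq rn 0 /\
          exists N0 : nat, forall n, (N0 <= n)%nat -> Tdiff d H (rn n) <= / (rn n ^ n)) /\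
    (exists H : vecR -> vecR -> R,
        real_entire d H /\ linear_plus_O2 d w H /\
        diffusive d H /\
        exists rn : nat -> R, (forall n, 0 < rn n) /\ is_lim_seq rn 0 /\
          forall n, Tdiff d H (rn n) <= / (rn n ^ 4)).
Proof.
  intros [|n] w Hd Hnr Hkb; [lia|].
  replace (S n - 1)%nat with n in Hkb by lia.
  split.
  - destruct (resonant_exists n w (fun j => (j + 2)%nat) ltac:(lia) Hnr Hkb) as (k & K & rho & HR).
    assert (HF := fast_decay_resonant _ _ (fun j => (j + 2)%nat) _ _ _ ltac:(intros; cbv beta; lia) HR).
    exists (ham (S n) w (fun j => RtoC (rho j)) (fun j => (j + 2)%nat) k).
    split; [eapply real_entire_ham; eauto; lia|].
    split; [eapply linear_plus_O2_ham; eauto; intros; cbv beta; lia|].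
    split; [apply (bnf_ham n w k K rho (res_last _ _ _ _ _ _ HR) (res_lam _ _ _ _ _ _ HR) (res_pos _ _ _ _ _ _ HR) HF)|].
    split; [eapply diffusive_ham; eauto; intros; cbv beta; lia|].
    (* With m_j = j + 2 the time on level ρ_j is ρ_j^-(j+4), so the n-th radius is ρ_(n-4). For n <
       4 truncated subtraction returns ρ_0, and the estimate is claimed from n = 4 on. *)
    exists (fun j => rho (j - 4)%nat). split; [intros; apply (res_pos _ _ _ _ _ _ HR)|]. split.
    + apply (is_lim_seq_incr_n _ 4). apply is_lim_seq_ext with rho.
      * intros j. f_equal. lia.
      * eapply rho_lim; eauto; intros; cbv beta; lia.
    + exists 4%nat. intros j Hj. replace j with ((j - 4) + 2 + 2)%nat at 3 by lia.
      eapply (Tdiff_ham_le (S n) w (fun j => (j + 2)%nat)); eauto; intros; cbv beta; lia.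
  - destruct (resonant_exists n w (fun _ => 2%nat) ltac:(lia) Hnr Hkb) as (k & K & rho & HR).
    assert (HF := fast_decay_resonant _ _ (fun _ => 2%nat) _ _ _ ltac:(intros; cbv beta; lia) HR).
    exists (ham (S n) w (fun j => RtoC (rho j)) (fun _ => 2%nat) k).
    split; [eapply real_entire_ham; eauto; lia|].
    split; [eapply linear_plus_O2_ham; eauto; intros; cbv beta; lia|].
    split; [eapply diffusive_ham; eauto; intros; cbv beta; lia|].
    exists rho. split; [apply (res_pos _ _ _ _ _ _ HR)|]. split.
    + eapply rho_lim; eauto; intros; cbv beta; lia.
    + intros j. eapply (Tdiff_ham_le (S n) w (fun _ => 2%nat)); eauto; intros; cbv beta; lia.
Qed.
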